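(* (i) For any modular fusion category $\mathcal C$ (over $\mathbb C$) such that $K(\mathcal C)$ is dual-Burnside, $$\frac{\big(\prod_{i=1}^md_i\big)^2}{\mathrm{FPdim}(\mathcal C_{ad})}\in\mathbb Z.$$ (ii) For any weakly-integral modular fusion category $\mathcal C$, $$\mathcal V(\mathcal C)=\mathcal V(\mathcal C_{pt})\cup\Big(\bigcup_{i=1}^m\mathcal V(d_i^2)\Big).$$
   Context: $X_1,\dots,X_m$ are representatives of the isomorphism classes of simple objects of $\mathcal C$, $x_i=[X_i]\in K(\mathcal C)$ (the Grothendieck ring), $d_i=\mathrm{FPdim}(X_i)$. $\mathcal C_{ad}$ is the adjoint fusion subcategory, generated by all $X_i\otimes X_i^*$; $\mathcal C_{pt}$ is the maximal pointed fusion subcategory, generated by the invertible simple objects. $\mathcal C$ is weakly-integral if $\mathrm{FPdim}(\mathcal C)\in\mathbb Z$ (then $d_i^2\in\mathbb Z$ for all $i$). For a non-negative integer $n$, $\mathcal V(n)$ is the set of prime divisors of $n$; $\mathcal V(\mathcal D):=\mathcal V(\mathrm{FPdim}(\mathcal D))$ for a weakly-integral fusion category $\mathcal D$. Let $H=K(\mathcal C)\otimes\mathbb C$ and let $\widehat{\mathcal B}=\{\mu_1=\mathrm{FPdim},\mu_2,\dots,\mu_m\}$ be the set of unital algebra morphisms $H\to\mathbb C$, a basis of $H^*$. The dual hypergroup of $K(\mathcal C)$ is $H^*$ with basis $\widehat{\mathcal B}$, product $(f\star g)(x_i/d_i)=f(x_i/d_i)g(x_i/d_i)$ for all $i$, unit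 $\mu_1$, involution $\mu_{j^\#}(x_i)=\mu_j([X_i^*])$. Write $\mu_i\star\mu_j=\sum_k\widehat p_k(i,j)\mu_k$; $\mu_j$ is grouplike in the dual if $\mu_j\star\mu_{j^\#}=\widehat p_1(j,j^\#)\mu_1$. $K(\mathcal C)$ is dual-Burnside if for every $\mu_j\in\widehat{\mathcal B}$: there is $i$ with $\mu_j(x_i)=0$ if and only if $\mu_j$ is not grouplike in the dual. *)

(* Defs.v *)
From HB Require Import structures.
From mathcomp Require Import all_boot all_order all_algebra.
From mathcomp Require Import complex.
From mathcomp Require Import boolp classical_sets reals.

Set Implicit Arguments.
Unset Strict Implicit.
Unset Printing Implicit Defensive.

Import Order.TTheory GRing.Theory Num.Theory.
Local Open Scope ring_scope.
Local Open Scope complex_scope.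

Declare Scope cat_scope.
Delimit Scope cat_scope with cat.

(* [vectType] makes every Hom space finite dimensional (locally finite
   category). *)
Record linCat (k : fieldType) := LinCat {
  obj :> Type;
  hom : obj -> obj -> vectType k;
  idm : forall X : obj, hom X X;
  comp : forall X Y Z : obj, hom Y Z -> hom X Y -> hom X Z;
  compA : forall (W X Y Z : obj) (h : hom Y Z) (g : hom X Y) (f : hom W X),
    comp h (comp g f) = comp (comp h g) f;
  comp1m : forall (X Y : obj) (f : hom X Y), comp (idm Y) f = f;
  compm1 : forall (X Y : obj) (f : hom X Y), comp f (idm X) = f;
  comp_linear_l : forall (X Y Z : obj) (f : hom X Y),
    linear (fun g : hom Y Z => comp g f);
  comp_linear_r : forall (X Y Z : obj) (g : hom Y Z),
    linear (fun f : hom X Y => comp g f)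
}.

Arguments hom {k l} _ _.
Arguments idm {k l} _.
Arguments comp {k l X Y Z} _ _.
Notation "g '∘' f" := (comp g f) (at level 40, left associativity) : cat_scope.
Local Open Scope cat_scope.

Section LinCatTheory.
Variables (k : fieldType) (C : linCat k).
Implicit Types X Y Z : C.

Definition is_iso X Y (f : hom X Y) :=
  exists g : hom Y X, g ∘ f = idm X /\ f ∘ g = idm Y.

Definition is_mono X Y (f : hom X Y) :=
  forall Z (g h : hom Z X), f ∘ g = f ∘ h -> g = h.

Definition is_epi X Y (f : hom X Y) :=
  forall Z (g h : hom Y Z), g ∘ f = h ∘ f -> g = h.

Definition is_kernel X Y K (f : hom X Y) (i : hom K X) :=
  f ∘ i = 0 /\
  forall Z (h : hom Z X), f ∘ h = 0 -> exists! u : hom Z K, i ∘ u = h.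

Definition is_cokernel X Y Q (f : hom X Y) (q : hom Y Q) :=
  q ∘ f = 0 /\
  forall Z (h : hom Y Z), h ∘ f = 0 -> exists! u : hom Q Z, u ∘ q = h.

Definition is_zero X :=
  (forall Y (f : hom X Y), f = 0) /\ (forall Y (f : hom Y X), f = 0).

Definition is_direct_sum n (S : 'I_n -> C) X :=
  exists (inj : forall i, hom (S i) X) (prj : forall i, hom X (S i)),
    [/\ forall i, prj i ∘ inj i = idm (S i),
        forall i j, i <> j -> prj i ∘ inj j = 0
      & \sum_i inj i ∘ prj i = idm X].

(* Finite direct sums include the empty one, i.e. the zero object. *)
Definition abelian_cat :=
  [/\ forall n (S : 'I_n -> C), exists X, is_direct_sum S X,
      forall X Y (f : hom X Y), exists K (i : hom K X), is_kernel f i,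
      forall X Y (f : hom X Y), exists Q (q : hom Y Q), is_cokernel f q,
      forall X Y (f : hom X Y), is_mono f ->
        exists Z (g : hom Y Z), is_kernel g f
    & forall X Y (f : hom X Y), is_epi f ->
        exists Z (g : hom Z X), is_cokernel g f].

Definition simple X :=
  ~ is_zero X /\
  forall Y (i : hom Y X), is_mono i -> is_zero Y \/ is_iso i.

Definition semisimple_cat :=
  forall X, exists n (S : 'I_n -> C),
    (forall i, simple (S i)) /\ is_direct_sum S X.

Definition isomorphic X Y := exists f : hom X Y, is_iso f.

Definition simple_reps m (X : 'I_m -> C) :=
  [/\ forall i, simple (X i),
      forall i j, isomorphic (X i) (X j) -> i = j
    & forall Y, simple Y -> exists i, isomorphic Y (X i)].

End LinCatTheory.

Record monCat (k : fieldType) := MonCat {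
  mon_cat :> linCat k;
  tens : mon_cat -> mon_cat -> mon_cat;
  tensm : forall X X' Y Y' : mon_cat,
    hom X X' -> hom Y Y' -> hom (tens X Y) (tens X' Y');
  tensm_id : forall X Y : mon_cat, tensm (idm X) (idm Y) = idm (tens X Y);
  tensm_comp : forall (X X' X'' Y Y' Y'' : mon_cat)
      (f' : hom X' X'') (f : hom X X') (g' : hom Y' Y'') (g : hom Y Y'),
    tensm (f' ∘ f) (g' ∘ g) = tensm f' g' ∘ tensm f g;
  tensm_linear_l : forall (X X' Y Y' : mon_cat) (g : hom Y Y'),
    linear (fun f : hom X X' => tensm f g);
  tensm_linear_r : forall (X X' Y Y' : mon_cat) (f : hom X X'),
    linear (fun g : hom Y Y' => tensm f g);
  munit : mon_cat;
  assoc : forall X Y Z : mon_cat,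
    hom (tens (tens X Y) Z) (tens X (tens Y Z));
  associ : forall X Y Z : mon_cat,
    hom (tens X (tens Y Z)) (tens (tens X Y) Z);
  lunit : forall X : mon_cat, hom (tens munit X) X;
  luniti : forall X : mon_cat, hom X (tens munit X);
  runit : forall X : mon_cat, hom (tens X munit) X;
  runiti : forall X : mon_cat, hom X (tens X munit);
  assocK : forall X Y Z, associ X Y Z ∘ assoc X Y Z = idm _;
  associK : forall X Y Z, assoc X Y Z ∘ associ X Y Z = idm _;
  lunitK : forall X, luniti X ∘ lunit X = idm _;
  lunitiK : forall X, lunit X ∘ luniti X = idm _;
  runitK : forall X, runiti X ∘ runit X = idm _;
  runitiK : forall X, runit X ∘ runiti X = idm _;
  assoc_nat : forall (X X' Y Y' Z Z' : mon_cat)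
      (f : hom X X') (g : hom Y Y') (h : hom Z Z'),
    assoc X' Y' Z' ∘ tensm (tensm f g) h =
    tensm f (tensm g h) ∘ assoc X Y Z;
  lunit_nat : forall (X X' : mon_cat) (f : hom X X'),
    lunit X' ∘ tensm (idm munit) f = f ∘ lunit X;
  runit_nat : forall (X X' : mon_cat) (f : hom X X'),
    runit X' ∘ tensm f (idm munit) = f ∘ runit X;
  pentagon : forall W X Y Z : mon_cat,
    tensm (idm W) (assoc X Y Z) ∘ assoc W (tens X Y) Z
      ∘ tensm (assoc W X Y) (idm Z) =
    assoc W X (tens Y Z) ∘ assoc (tens W X) Y Z;
  triangle : forall X Y : mon_cat,
    tensm (idm X) (lunit Y) ∘ assoc X munit Y = tensm (runit X) (idm Y)
}.

Arguments tens {k m} _ _.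
Arguments tensm {k m X X' Y Y'} _ _.
Arguments munit {k m}.
Arguments assoc {k m} X Y Z.
Arguments associ {k m} X Y Z.
Arguments lunit {k m} X.
Arguments luniti {k m} X.
Arguments runit {k m} X.
Arguments runiti {k m} X.
Notation "X ⊗ Y" := (tens X Y) (at level 38, left associativity) : cat_scope.
Notation "f ⊗m g" := (tensm f g) (at level 38, left associativity) : cat_scope.

(* [Y] is a left dual of [X], equivalently [X] is a right dual of [Y]. *)
Definition dual_pair (k : fieldType) (C : monCat k) (Y X : C)
    (ev : hom (Y ⊗ X) munit) (coev : hom munit (X ⊗ Y)) :=
  runit X ∘ (idm X ⊗m ev) ∘ assoc X Y X ∘ (coev ⊗m idm X) ∘ luniti X = idm X /\
  lunit Y ∘ (ev ⊗m idm Y) ∘ associ Y X Y ∘ (idm Y ⊗m coev) ∘ runiti Y = idm Y.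

Record fusionCat (k : fieldType) := FusionCat {
  fus_mon :> monCat k;
  ldual : fus_mon -> fus_mon;
  ev : forall X : fus_mon, hom (ldual X ⊗ X) munit;
  coev : forall X : fus_mon, hom munit (X ⊗ ldual X);
  ldualP : forall X, dual_pair (ev X) (coev X);
  rdualP : forall X : fus_mon,
    exists (Y : fus_mon) (e : hom (X ⊗ Y) munit) (c : hom munit (Y ⊗ X)),
      dual_pair e c;
  fus_abelian : abelian_cat fus_mon;
  fus_semisimple : semisimple_cat fus_mon;
  fus_finite : exists m (X : 'I_m -> fus_mon), simple_reps X;
  fus_unit : \dim {: hom (munit : fus_mon) munit } = 1%N
}.

Arguments ldual {k f} X.
Arguments ev {k f} X.
Arguments coev {k f} X.
Notation "X ^∨" := (ldual X) (at level 2, format "X ^∨") : cat_scope.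

Definition dualm (k : fieldType) (C : fusionCat k) (X Y : C) (f : hom X Y) :
    hom Y^∨ X^∨ :=
  lunit _ ∘ (ev Y ⊗m idm X^∨) ∘ ((idm Y^∨ ⊗m f) ⊗m idm X^∨)
    ∘ associ Y^∨ X X^∨ ∘ (idm Y^∨ ⊗m coev X) ∘ runiti _.

Record ribbonCat (k : fieldType) := RibbonCat {
  rib_fus :> fusionCat k;
  braid : forall X Y : rib_fus, hom (X ⊗ Y) (Y ⊗ X);
  braid_iso : forall X Y, is_iso (braid X Y);
  braid_nat : forall (X X' Y Y' : rib_fus) (f : hom X X') (g : hom Y Y'),
    braid X' Y' ∘ (f ⊗m g) = (g ⊗m f) ∘ braid X Y;
  hexagon1 : forall X Y Z : rib_fus,
    assoc Y Z X ∘ braid X (Y ⊗ Z) ∘ assoc X Y Z =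
    (idm Y ⊗m braid X Z) ∘ assoc Y X Z ∘ (braid X Y ⊗m idm Z);
  hexagon2 : forall X Y Z : rib_fus,
    associ Z X Y ∘ braid (X ⊗ Y) Z ∘ associ X Y Z =
    (braid X Z ⊗m idm Y) ∘ associ X Z Y ∘ (idm X ⊗m braid Y Z);
  twist : forall X : rib_fus, hom X X;
  twist_iso : forall X, is_iso (twist X);
  twist_nat : forall (X Y : rib_fus) (f : hom X Y),
    twist Y ∘ f = f ∘ twist X;
  twist_tens : forall X Y : rib_fus,
    twist (X ⊗ Y) = braid Y X ∘ braid X Y ∘ (twist X ⊗m twist Y);
  twist_dual : forall X : rib_fus, twist X^∨ = dualm (twist X)
}.

Arguments braid {k r} X Y.
Arguments twist {k r} X.

Section Trace.
Variables (k : fieldType) (C : ribbonCat k).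

(* The a with f = a *: id, as End(1) is spanned by the identity. *)
Definition scalar_of (f : hom (munit : C) munit) : k :=
  coord [tuple idm (munit : C)] ord0 f.

(* The ribbon trace; composing with the braiding and the twist replaces the
   evaluation X ⊗ X^∨ -> 1 given by the spherical structure. *)
Definition qtrace (X : C) (f : hom X X) : k :=
  scalar_of (ev X ∘ braid X X^∨ ∘ ((twist X ∘ f) ⊗m idm X^∨) ∘ coev X).

Definition Smatrix m (X : 'I_m -> C) : 'M[k]_m :=
  \matrix_(i, j) qtrace (braid (X j) (X i) ∘ braid (X i) (X j)).

End Trace.

Record modularCat (k : fieldType) := ModularCat {
  mod_rib :> ribbonCat k;
  Smatrix_unit : forall m (X : 'I_m -> mod_rib),
    simple_reps X -> Smatrix X \in unitmx
}.

Section Subcategories.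
Variables (k : fieldType) (C : fusionCat k).

(* Full subcategories are given by their class of objects; closure under
   isomorphism is the closure under subobjects applied to an isomorphism. *)
Definition fusion_subcat (D : C -> Prop) :=
  [/\ D munit,
      forall X Y, D X -> D Y -> D (X ⊗ Y),
      forall X, D X -> D X^∨,
      forall n (S : 'I_n -> C) X,
        (forall i, D (S i)) -> is_direct_sum S X -> D X
    & forall X Y (i : hom Y X), is_mono i -> D X -> D Y].

Definition gen_subcat (G : C -> Prop) (X : C) :=
  forall D, fusion_subcat D -> (forall Y, G Y -> D Y) -> D X.

Definition invertible (X : C) := is_iso (ev X) /\ is_iso (coev X).

Definition adjoint_subcat : C -> Prop :=
  gen_subcat (fun Y => exists2 X, simple X & Y = X ⊗ X^∨).

Definition pointed_subcat : C -> Prop :=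
  gen_subcat (fun Y => simple Y /\ invertible Y).

End Subcategories.

Section Grothendieck.
Variables (R : realType) (C : fusionCat R[i]).
Variables (m : nat) (X : 'I_m -> C).

(* The multiplicity of the simple object [X j] in [Y]: C is semisimple over an
   algebraically closed field, so Hom(X j, X l) has dimension (j == l). *)
Definition mult (j : 'I_m) (Y : C) : nat := \dim {: hom (X j) Y}.

(* Matrix of the left multiplication by [Y] on the Grothendieck ring: its j-th
   row is the class of [Y ⊗ X j]. *)
Definition lmulmx (Y : C) : 'M[R]_m :=
  \matrix_(j, l) (mult l (Y ⊗ X j))%:R.

(* The largest nonnegative eigenvalue: the set is finite, and nonempty by the
   Frobenius-Perron theorem, so the supremum is a maximum. *)
Definition FPdim_obj (Y : C) : R :=
  sup [set a : R | 0 <= a /\ eigenvalue (lmulmx Y) a]%classic.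

Definition FPdim_simple (i : 'I_m) : R := FPdim_obj (X i).

(* For a fusion subcategory D, whose simple objects are, up to isomorphism,
   the X i in D. *)
Definition FPdim_sub (D : C -> Prop) : R :=
  \sum_(i | `[< D (X i) >]) FPdim_simple i ^+ 2.

Definition FPdim_cat : R := \sum_i FPdim_simple i ^+ 2.

Definition weakly_integral := FPdim_cat \is a Num.int.

(* The complexified Grothendieck ring H, with basis the x_i = [X i]. *)
Definition groth : vectType R[i] := 'rV[R[i]]_m.

Definition groth_class (Y : C) : groth := \row_j (mult j Y)%:R.

Definition groth_basis (i : 'I_m) : groth := delta_mx 0 i.

Definition groth_mul (u v : groth) : groth :=
  \sum_i \sum_j (u 0 i * v 0 j) *: groth_class (X i ⊗ X j).

Definition groth_dual : vectType R[i] := 'Hom(groth, (R[i])^o).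

Definition extend (v : 'I_m -> R[i]) : groth_dual :=
  linfun (fun h : groth => \sum_i h 0 i * v i : (R[i])^o).

Lemma extendE v i : extend v (groth_basis i) = v i.
Proof.
pose g := fun h : groth => \sum_i h 0 i * v i : (R[i])^o.
have glin : linear g.
  move=> a x y; rewrite /g scaler_sumr -big_split /=; apply: eq_bigr => j _.
  by rewrite !mxE mulrDl -mulrA.
pose gl : {linear groth -> (R[i])^o} :=
  HB.pack g (GRing.isLinear.Build R[i] groth (R[i])^o *:%R g glin).
rewrite /extend (_ : (fun h : groth => _) = gl) // lfunE /= /g.
rewrite (bigD1 i) //= big1 => [|j ji]; first by rewrite mxE !eqxx mul1r addr0.
by rewrite mxE (negPf ji) andbF mul0r.
Qed.

Definition algebra_morphism (f : groth_dual) :=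
  f (groth_class munit) = 1 /\
  forall u v, f (groth_mul u v) = f u * f v :> R[i].

Definition FPdim_char : groth_dual :=
  extend (fun i => (FPdim_simple i)%:C).

(* The functional determined by (f ⋆ g)(x_i/d_i) = f(x_i/d_i) g(x_i/d_i). *)
Definition star (f g : groth_dual) : groth_dual :=
  extend (fun i =>
    f (groth_basis i) * g (groth_basis i) / (FPdim_simple i)%:C).

Definition sharp (f : groth_dual) : groth_dual :=
  extend (fun i => f (groth_class (X i)^∨)).

(* The index [j1] plays the role of 1: mu_1 = FPdim. *)
Definition dual_basis (mu : m.-tuple groth_dual) (j1 : 'I_m) :=
  [/\ uniq mu,
      forall f, algebra_morphism f <-> f \in mu
    & tnth mu j1 = FPdim_char].

(* [coord mu l (star (tnth mu i) (tnth mu j))] is the structure constant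
   \widehat p_l(i, j). *)
Definition dual_grouplike (mu : m.-tuple groth_dual) (j1 j : 'I_m) :=
  let prod := star (tnth mu j) (sharp (tnth mu j)) in
  prod = coord mu j1 prod *: tnth mu j1.

Definition dual_Burnside :=
  exists (mu : m.-tuple groth_dual) (j1 : 'I_m),
    dual_basis mu j1 /\
    forall j, (exists i, tnth mu j (groth_basis i) = 0) <->
              ~ dual_grouplike mu j1 j.

End Grothendieck.

(* Prime divisors of the natural number x, for x in R. *)
Definition prime_divisors (R : realType) (x : R) : set nat :=
  [set p | exists n : nat, x = n%:R /\ prime p /\ (p %| n)%N]%classic.

(* Main.v *)
(* Write x_i = [X_i], d_i = FPdim X_i and D = FPdim C.

   (i) Let y be the product of all x_i x_i^*.  A character with a zero kills y;
   a character without zero is grouplike, so |mu(x_i)| = d_i for all i, and it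
   agrees with FPdim on the constituents of the x_i x_i^*, i.e. on C_ad.  Hence
   x_i y = d_i y for X_i in C_ad, and as y is supported on C_ad it is
   c sum_(X_i in C_ad) d_i x_i, where the integer c is its coefficient at 1.
   Taking FPdim, (prod d_i)^2 = c FPdim(C_ad).

   (ii) Encircling X_i by X_j acts on X_i by a scalar chi_i(x_j) with
   S_ij = chi_i(x_j) dim X_i; each chi_i is a character of the Grothendieck ring,
   and chi_i(x_j) dim X_i is symmetric.  By orthogonality, with
   n_l = sum_j |chi_l(x_j)|^2, the number n_l |dim X_l|^2 does not depend on l.
   FPdim is one of the chi_l, with n_l = D; all n_l are at most D, and if D is an
   integer the n_l / D are permuted by Galois conjugation, which forces
   |dim X_l| = d_l.  Hence n_l = D / d_l^2 and d_l^2 are integers, and AM-GM as in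
   Burnside's theorem shows that chi_l has a zero unless d_l = 1.  For y and c as
   in (i), column orthogonality gives c D = |G| prod d_i^2, G being the group of
   invertible objects, so D divides |G| prod d_i^2 and |G| divides D.
   Instead of Galois groups we use rational matrices diagonalized by the
   character table. *)

From HB Require Import structures.
Require Import Defs.
From mathcomp Require Import all_boot all_order all_algebra all_field.
From mathcomp Require Import complex ring.
From mathcomp Require Import boolp classical_sets reals.
Import Defs.

Set Implicit Arguments.
Unset Strict Implicit.
Unset Printing Implicit Defensive.

Import Order.TTheory GRing.Theory Num.Theory.
Local Open Scope ring_scope.
Local Open Scope cat_scope.

(** The ribbon structure is arbitrary: dim X_l need not be positive, so at the start nothing relates
    it to d_l, and orthogonality of the S-matrix only sees |dim X_l|. Integrality of D makes the
    comparison possible: an algebraic integer all of whose conjugates lie in (0, 1] has a positive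
    integer as norm, hence is 1. The Galois action on characters is replaced by functions of l that
    are the eigenvalues of one rational matrix: their sum and product over l are its trace and
    determinant, hence rational, and the indicator of a rational level set is again such a function.
    The diagrammatic core is that encircling is multiplicative in the loop. The obstacles are the
    associators and the fact that (Y ⊗ Z)^* is only isomorphic to Z^* ⊗ Y^*. Therefore objects act
    on an auxiliary object W, where diagrams compose strictly, and a dual is any object with
    suitable cups and caps, so that one dual can be traded for another under a trace. That FPdim is
    among the chi_l uses that the chi_l form a basis, with Perron-Frobenius applied to the sum of
    all x_i. *)

(** * Linear and monoidal coherence *)

Section LinearComposition.
Variables (k : fieldType) (C : linCat k).
Implicit Types W X Y Z : C.

Lemma compDl X Y Z (g h : hom Y Z) (f : hom X Y) : (g + h) ∘ f = g ∘ f + h ∘ f.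
Proof. by have := comp_linear_l f 1 g h; rewrite !scale1r. Qed.

Lemma compDr X Y Z (g : hom Y Z) (f h : hom X Y) : g ∘ (f + h) = g ∘ f + g ∘ h.
Proof. by have := comp_linear_r g 1 f h; rewrite !scale1r. Qed.

Lemma comp0l X Y Z (f : hom X Y) : (0 : hom Y Z) ∘ f = 0.
Proof. by apply: (addIr (0 ∘ f)); rewrite -compDl !add0r. Qed.

Lemma comp0r X Y Z (g : hom Y Z) : g ∘ (0 : hom X Y) = 0.
Proof. by apply: (addIr (g ∘ 0)); rewrite -compDr !add0r. Qed.

Lemma compZl X Y Z a (g : hom Y Z) (f : hom X Y) : (a *: g) ∘ f = a *: (g ∘ f).
Proof. by have := comp_linear_l f a g 0; rewrite !addr0 comp0l addr0. Qed.

Lemma compZr X Y Z a (g : hom Y Z) (f : hom X Y) : g ∘ (a *: f) = a *: (g ∘ f).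
Proof. by have := comp_linear_r g a f 0; rewrite !addr0 comp0r addr0. Qed.

Lemma comp_suml X Y Z (I : finType) (g : I -> hom Y Z) (f : hom X Y) :
  (\sum_i g i) ∘ f = \sum_i g i ∘ f.
Proof. by apply: (big_morph (fun h => h ∘ f)) => [g1 g2|]; rewrite ?compDl ?comp0l. Qed.

Lemma comp_sumr X Y Z (I : finType) (g : hom Y Z) (f : I -> hom X Y) :
  g ∘ (\sum_i f i) = \sum_i g ∘ f i.
Proof. by apply: (big_morph (fun h => g ∘ h)) => [g1 g2|]; rewrite ?compDr ?comp0r. Qed.

Lemma reassoc X Y Y' Z W (a : hom Y Z) (b : hom X Y) (c : hom Y' Z) (d : hom X Y') :
  a ∘ b = c ∘ d -> forall x : hom W X, a ∘ (b ∘ x) = c ∘ (d ∘ x).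
Proof. by move=> e x; rewrite !compA e. Qed.

Lemma reassoc1 X Y Z W (a : hom Y Z) (b : hom X Y) (c : hom X Z) :
  a ∘ b = c -> forall x : hom W X, a ∘ (b ∘ x) = c ∘ x.
Proof. by move=> <- x; rewrite !compA. Qed.

Lemma compKl X Y Z (f : hom Y X) (g : hom X Y) (h : hom Z X) :
  f ∘ g = idm X -> f ∘ (g ∘ h) = h.
Proof. by move=> fg; rewrite compA fg comp1m. Qed.

Lemma comp_cancel_r X Y Z (u v : hom Y Z) (f : hom X Y) (g : hom Y X) :
  f ∘ g = idm Y -> u ∘ f = v ∘ f -> u = v.
Proof. by move=> fg uv; rewrite -[u]compm1 -[v]compm1 -fg !compA uv. Qed.

Lemma comp_cancel_l X Y Z (u v : hom Z X) (f : hom X Y) (g : hom Y X) :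
  g ∘ f = idm X -> f ∘ u = f ∘ v -> u = v.
Proof. by move=> gf uv; rewrite -[u]comp1m -[v]comp1m -gf -!compA uv. Qed.

End LinearComposition.

Section Coherence.
Variables (k : fieldType) (C : monCat k).
Implicit Types W X Y Z V : C.

Notation "X ◁ f" := (tensm (idm X) f) (at level 37, right associativity) : cat_scope.
Notation "f ▷ X" := (tensm f (idm X)) (at level 38, left associativity) : cat_scope.

Lemma lwhisk_comp X Y Y' Y'' (g : hom Y' Y'') (f : hom Y Y') :
  X ◁ (g ∘ f) = (X ◁ g) ∘ (X ◁ f).
Proof. by rewrite -tensm_comp comp1m. Qed.

Lemma rwhisk_comp X Y Y' Y'' (g : hom Y' Y'') (f : hom Y Y') :
  (g ∘ f) ▷ X = (g ▷ X) ∘ (f ▷ X).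
Proof. by rewrite -tensm_comp comp1m. Qed.

Lemma whiskC X X' Y Y' (f : hom X X') (g : hom Y Y') :
  (X' ◁ g) ∘ (f ▷ Y) = (f ▷ Y') ∘ (X ◁ g).
Proof. by rewrite -!tensm_comp !comp1m !compm1. Qed.

Lemma tensmE X X' Y Y' (f : hom X X') (g : hom Y Y') :
  f ⊗m g = (f ▷ Y') ∘ (X ◁ g).
Proof. by rewrite -tensm_comp comp1m compm1. Qed.

Lemma tensmDl X X' Y Y' (f h : hom X X') (g : hom Y Y') :
  (f + h) ⊗m g = f ⊗m g + h ⊗m g.
Proof. by have := tensm_linear_l g 1 f h; rewrite !scale1r. Qed.

Lemma tensmDr X X' Y Y' (f : hom X X') (g h : hom Y Y') :
  f ⊗m (g + h) = f ⊗m g + f ⊗m h.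
Proof. by have := tensm_linear_r f 1 g h; rewrite !scale1r. Qed.

Lemma tensm0l X X' Y Y' (g : hom Y Y') : (0 : hom X X') ⊗m g = 0.
Proof. by apply: (addIr (0 ⊗m g)); rewrite -tensmDl !add0r. Qed.

Lemma tensm0r X X' Y Y' (f : hom X X') : f ⊗m (0 : hom Y Y') = 0.
Proof. by apply: (addIr (f ⊗m 0)); rewrite -tensmDr !add0r. Qed.

Lemma tensmZl X X' Y Y' a (f : hom X X') (g : hom Y Y') :
  (a *: f) ⊗m g = a *: (f ⊗m g).
Proof. by have := tensm_linear_l g a f 0; rewrite !addr0 tensm0l addr0. Qed.

Lemma tensmZr X X' Y Y' a (f : hom X X') (g : hom Y Y') :
  f ⊗m (a *: g) = a *: (f ⊗m g).
Proof. by have := tensm_linear_r f a g 0; rewrite !addr0 tensm0r addr0. Qed.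

Lemma tensm_suml X X' Y Y' (I : finType) (f : I -> hom X X') (g : hom Y Y') :
  (\sum_i f i) ⊗m g = \sum_i f i ⊗m g.
Proof. by apply: (big_morph (fun h => h ⊗m g)) => [a b|]; rewrite ?tensmDl ?tensm0l. Qed.

Lemma tensm_sumr X X' Y Y' (I : finType) (f : hom X X') (g : I -> hom Y Y') :
  f ⊗m (\sum_i g i) = \sum_i f ⊗m g i.
Proof. by apply: (big_morph (fun h => f ⊗m h)) => [a b|]; rewrite ?tensmDr ?tensm0r. Qed.

Lemma lwhiskK X Y Z (f : hom Y Z) (g : hom Z Y) :
  g ∘ f = idm Y -> (X ◁ g) ∘ (X ◁ f) = idm _.
Proof. by move=> gf; rewrite -lwhisk_comp gf tensm_id. Qed.

Lemma rwhiskK X Y Z (f : hom Y Z) (g : hom Z Y) :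
  g ∘ f = idm Y -> (g ▷ X) ∘ (f ▷ X) = idm _.
Proof. by move=> gf; rewrite -rwhisk_comp gf tensm_id. Qed.

Lemma lunit_faithful X Y (f g : hom X Y) : munit ◁ f = munit ◁ g -> f = g.
Proof.
move=> fg; apply: (comp_cancel_r (lunitiK X)).
by rewrite -!lunit_nat fg.
Qed.

Lemma runit_faithful X Y (f g : hom X Y) : f ▷ munit = g ▷ munit -> f = g.
Proof.
move=> fg; apply: (comp_cancel_r (runitiK X)).
by rewrite -!runit_nat fg.
Qed.

Lemma associ_nat X X' Y Y' Z Z' (f : hom X X') (g : hom Y Y') (h : hom Z Z') :
  associ X' Y' Z' ∘ (f ⊗m (g ⊗m h)) = ((f ⊗m g) ⊗m h) ∘ associ X Y Z.
Proof.
apply: (comp_cancel_r (associK X Y Z)); rewrite -!compA -assoc_nat assocK compm1.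
by rewrite compA assocK comp1m.
Qed.

(* Kelly's lemma *)
Lemma lunit_tens X Y : lunit (X ⊗ Y) ∘ assoc munit X Y = lunit X ▷ Y.
Proof.
apply: lunit_faithful; rewrite lwhisk_comp.
have iso1 : assoc munit (munit ⊗ X) Y ∘ (assoc munit munit X ▷ Y) ∘
   ((associ munit munit X ▷ Y) ∘ associ munit (munit ⊗ X) Y) = idm _.
  by rewrite -compA (compA (assoc munit munit X ▷ Y)) rwhiskK ?associK // comp1m associK.
apply: (comp_cancel_r iso1).
have := pentagon munit munit X Y; rewrite -!compA => pent.
rewrite pent compA triangle.
rewrite (compA (munit ◁ (lunit X ▷ Y))) -assoc_nat -compA -rwhisk_comp triangle.
by rewrite -(tensm_id X Y) assoc_nat.
Qed.

Lemma runit_tens X Y : (X ◁ runit Y) ∘ assoc X Y munit = runit (X ⊗ Y).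
Proof.
apply: runit_faithful; rewrite rwhisk_comp.
apply: (comp_cancel_l (assocK X Y munit)).
rewrite compA assoc_nat -triangle lwhisk_comp.
have := pentagon X Y munit munit; rewrite -!compA => ->.
by rewrite compA -assoc_nat tensm_id -compA triangle.
Qed.

Lemma lunit_runit : lunit (munit : C) = runit munit.
Proof.
apply: runit_faithful; rewrite -triangle -lunit_tens.
congr (_ ∘ _); apply: (comp_cancel_l (lunitK _)); exact/esym/lunit_nat.
Qed.

Lemma luniti_tens X Y : luniti (X ⊗ Y) = assoc munit X Y ∘ (luniti X ▷ Y).
Proof.
apply: (comp_cancel_l (lunitK _)); rewrite lunitiK.
by rewrite compA lunit_tens rwhiskK ?lunitiK.
Qed.

Lemma lwhisk_luniti X Y : X ◁ luniti Y = assoc X munit Y ∘ (runiti X ▷ Y).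
Proof.
apply: (comp_cancel_l (lwhiskK X (lunitK Y))).
rewrite lwhiskK ?lunitiK // compA triangle rwhiskK ?runitiK //.
Qed.

(* A word X1 ... Xn acts on W as X1 ⊗ (X2 ⊗ ... ⊗ W): on this action the
   associator disappears, so that string diagrams can be computed strictly. *)
Fixpoint wob (s : seq C) W : C := if s is X :: s' then X ⊗ wob s' W else W.

Fixpoint wmap (s : seq C) W W' (h : hom W W') : hom (wob s W) (wob s W') :=
  match s with
  | [::] => h
  | X :: s' => X ◁ wmap s' h
  end.

Fixpoint wstr (s : seq C) W V : hom (wob s W ⊗ V) (wob s (W ⊗ V)) :=
  match s with
  | [::] => idm _
  | X :: s' => (X ◁ wstr s' W V) ∘ assoc X (wob s' W) V
  end.

(** Morphisms between the functors given by words, seen as right module functors over C: natural in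
    W and compatible with tensoring by V on the right. *)
Definition wtrans (s t : seq C) (T : forall W, hom (wob s W) (wob t W)) :=
  (forall W W' (h : hom W W'), T W' ∘ wmap s h = wmap t h ∘ T W) /\
  (forall W V, T (W ⊗ V) ∘ wstr s W V = wstr t W V ∘ (T W ▷ V)).

Lemma wmap_comp s X Y Z (g : hom Y Z) (f : hom X Y) :
  wmap s (g ∘ f) = wmap s g ∘ wmap s f.
Proof. by elim: s => //= V s ->; rewrite lwhisk_comp. Qed.

Lemma eq_wtrans s t T U : (forall W, T W = U W) -> @wtrans s t T -> @wtrans s t U.
Proof. by move=> TU [nT sT]; split=> *; rewrite -!TU. Qed.

Lemma wtrans_comp s t u T U :
  @wtrans t u U -> @wtrans s t T -> @wtrans s u (fun W => U W ∘ T W).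
Proof.
move=> [nU sU] [nT sT]; split=> [W W' h | W V].
  by rewrite -compA nT compA nU compA.
by rewrite -compA sT compA sU -compA rwhisk_comp.
Qed.

Lemma wtrans_l X s t T :
  @wtrans s t T -> @wtrans (X :: s) (X :: t) (fun W => X ◁ T W).
Proof.
move=> [nT sT]; split=> [W W' h | W V] /=; first by rewrite -!lwhisk_comp nT.
by rewrite compA -lwhisk_comp sT -compA assoc_nat lwhisk_comp compA.
Qed.

Lemma wtrans_mor X Y (f : hom X Y) u :
  @wtrans (X :: u) (Y :: u) (fun W => f ▷ wob u W).
Proof.
split=> [W W' h | W V] /=; first by rewrite whiskC.
by rewrite compA -whiskC -!compA assoc_nat tensm_id.
Qed.

Lemma wtrans_assoc X Y u :
  @wtrans (X ⊗ Y :: u) (X :: Y :: u) (fun W => assoc X Y (wob u W)).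
Proof.
split=> [W W' h | W V] /=; first by rewrite -assoc_nat tensm_id.
rewrite lwhisk_comp -!compA.
have := pentagon X Y (wob u W) V; rewrite -!compA => ->.
by rewrite compA -(tensm_id X Y) assoc_nat !compA.
Qed.

Lemma wtrans_inv s t T (U : forall W, hom (wob t W) (wob s W)) :
  (forall W, U W ∘ T W = idm _) -> (forall W, T W ∘ U W = idm _) ->
  @wtrans s t T -> @wtrans t s U.
Proof.
move=> UT TU [nT sT]; split=> [W W' h | W V].
  by apply: (comp_cancel_r (TU W)); rewrite -!compA UT compm1 -nT compKl.
apply: (comp_cancel_r (rwhiskK V (TU W))).
by rewrite -!compA -sT compKl // rwhiskK ?compm1.
Qed.

Lemma wtrans_associ X Y u :
  @wtrans (X :: Y :: u) (X ⊗ Y :: u) (fun W => associ X Y (wob u W)).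
Proof.
by apply: wtrans_inv (wtrans_assoc X Y u) => W; rewrite ?assocK ?associK.
Qed.

Lemma wtrans_lunit u : @wtrans (munit :: u) u (fun W => lunit (wob u W)).
Proof.
split=> [W W' h | W V] /=; first exact: lunit_nat.
by rewrite compA lunit_nat -compA lunit_tens.
Qed.

Lemma wtrans_luniti u : @wtrans u (munit :: u) (fun W => luniti (wob u W)).
Proof.
by apply: wtrans_inv (wtrans_lunit u) => W; rewrite ?lunitK ?lunitiK.
Qed.

(** Since W is 1 ⊗ W, compatibility with the right action determines T by its component at the unit;
    [t] is that component, conjugated by the unitors. *)
Lemma wtrans_rep X Y T : @wtrans [:: X] [:: Y] T ->
  exists t : hom X Y, forall W, T W = t ▷ W.
Proof.
move=> [nT sT]; exists (runit Y ∘ T munit ∘ runiti X) => W.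
apply: (comp_cancel_r (lwhiskK X (lunitiK W))).
have /= -> := nT _ _ (lunit W).
apply: (comp_cancel_r (associK X munit W)).
have := sT munit W; rewrite /= !tensm_id !comp1m => e.
rewrite -compA e compA triangle -compA triangle -!rwhisk_comp.
by rewrite -!compA runitK compm1.
Qed.

(* Duals in module form.  The transformations are required to extend along every
   word u, because wob (s ++ u) is wob s (wob u) only for explicit words s. *)
Record dpair X := DPair {
  dob : C;
  evf : forall W, hom (dob ⊗ (X ⊗ W)) W;
  cof : forall W, hom W (X ⊗ (dob ⊗ W));
  evf_wtrans : forall u, @wtrans [:: dob, X & u] u (fun W => evf (wob u W));
  cof_wtrans : forall u, @wtrans u [:: X, dob & u] (fun W => cof (wob u W));
  zig1 : forall W, (X ◁ evf W) ∘ cof (X ⊗ W) = idm (X ⊗ W);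
  zig2 : forall W, evf (dob ⊗ W) ∘ (dob ◁ cof W) = idm (dob ⊗ W)
}.

Lemma evf_nat X (P : dpair X) W W' (h : hom W W') :
  evf P W' ∘ (dob P ◁ (X ◁ h)) = h ∘ evf P W.
Proof. exact: (evf_wtrans P [::]).1. Qed.

Lemma cof_nat X (P : dpair X) W W' (h : hom W W') :
  cof P W' ∘ h = (X ◁ (dob P ◁ h)) ∘ cof P W.
Proof. exact: (cof_wtrans P [::]).1. Qed.

(** The cap of a pairing acting on W. It is locked so that a cap stays a single piece of a diagram
    under rewriting. *)
Definition pairf X Y (e : hom (X ⊗ Y) munit) W : hom (X ⊗ (Y ⊗ W)) W :=
  locked (lunit W ∘ (e ▷ W) ∘ associ X Y W).

Lemma pairfE X Y (e : hom (X ⊗ Y) munit) W :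
  pairf e W = lunit W ∘ (e ▷ W) ∘ associ X Y W.
Proof. by rewrite /pairf -lock. Qed.

Definition copairf X Y (c : hom munit (X ⊗ Y)) W : hom W (X ⊗ (Y ⊗ W)) :=
  locked (assoc X Y W ∘ (c ▷ W) ∘ luniti W).

Lemma copairfE X Y (c : hom munit (X ⊗ Y)) W :
  copairf c W = assoc X Y W ∘ (c ▷ W) ∘ luniti W.
Proof. by rewrite /copairf -lock. Qed.

Lemma pairf_wtrans X Y (e : hom (X ⊗ Y) munit) u :
  @wtrans [:: X, Y & u] u (fun W => pairf e (wob u W)).
Proof.
apply: (@eq_wtrans [:: X, Y & u] u _ _ (fun W => esym (pairfE e (wob u W)))).
apply: (wtrans_comp (t := X ⊗ Y :: u)); last exact: wtrans_associ.
apply: (wtrans_comp (t := munit :: u)); last exact: wtrans_mor.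
exact: wtrans_lunit.
Qed.

Lemma copairf_wtrans X Y (c : hom munit (X ⊗ Y)) u :
  @wtrans u [:: X, Y & u] (fun W => copairf c (wob u W)).
Proof.
apply: (@eq_wtrans u [:: X, Y & u] _ _ (fun W => esym (copairfE c (wob u W)))).
apply: (wtrans_comp (t := munit :: u)); last exact: wtrans_luniti.
apply: (wtrans_comp (t := X ⊗ Y :: u)); last exact: wtrans_mor.
exact: wtrans_assoc.
Qed.

(** Pentagon and triangle move W out of the diagram; what remains is the zigzag identity of [e] and
    [c], tensored with W. *)
Lemma dual_pair_zig1 X D (e : hom (D ⊗ X) munit) (c : hom munit (X ⊗ D)) W :
  dual_pair e c -> (X ◁ pairf e W) ∘ copairf c (X ⊗ W) = idm (X ⊗ W).
Proof.
move=> [H _]; rewrite pairfE copairfE luniti_tens !lwhisk_comp -!compA.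
have e1 : (c ▷ (X ⊗ W)) ∘ assoc munit X W = assoc _ X W ∘ ((c ▷ X) ▷ W).
  by rewrite assoc_nat tensm_id.
rewrite (reassoc e1).
have := pentagon X D X W; rewrite -!compA => /esym e2.
rewrite (compA (assoc X D _)) e2 -!compA.
rewrite (reassoc1 (lwhiskK X (assocK D X W))) comp1m.
rewrite (reassoc (esym (assoc_nat (idm X) e (idm W)))).
by rewrite (reassoc1 (triangle X W)) -!rwhisk_comp !compA H tensm_id.
Qed.

Lemma dual_pair_zig2 X D (e : hom (D ⊗ X) munit) (c : hom munit (X ⊗ D)) W :
  dual_pair e c -> pairf e (D ⊗ W) ∘ (D ◁ copairf c W) = idm (D ⊗ W).
Proof.
move=> [_ H]; rewrite pairfE copairfE !lwhisk_comp lwhisk_luniti -!compA.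
rewrite (reassoc (esym (assoc_nat (idm D) c (idm W)))).
have e2 : associ D X (D ⊗ W) ∘ ((D ◁ assoc X D W) ∘ assoc D (X ⊗ D) W) =
   assoc (D ⊗ X) D W ∘ (associ D X D ▷ W).
  apply: (comp_cancel_r (rwhiskK W (associK D X D))).
  rewrite -!compA rwhiskK ?assocK // compm1.
  have := pentagon D X D W; rewrite -!compA => ->.
  by rewrite compA assocK comp1m.
rewrite (compA (D ◁ _) (assoc _ _ _)) (reassoc e2).
have e1 : (e ▷ (D ⊗ W)) ∘ assoc (D ⊗ X) D W = assoc munit D W ∘ ((e ▷ D) ▷ W).
  by rewrite assoc_nat tensm_id.
by rewrite (reassoc e1) (reassoc1 (lunit_tens D W)) -!rwhisk_comp !compA H tensm_id.
Qed.

Definition dpair_of X D (e : hom (D ⊗ X) munit) (c : hom munit (X ⊗ D))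
    (ec : dual_pair e c) : dpair X :=
  DPair (pairf_wtrans e) (copairf_wtrans c)
    (fun W => dual_pair_zig1 W ec) (fun W => dual_pair_zig2 W ec).

End Coherence.

Notation "X ◁ f" := (tensm (idm X) f) (at level 37, right associativity) : cat_scope.
Notation "f ▷ X" := (tensm f (idm X)) (at level 38, left associativity) : cat_scope.

(** * Partial traces and encircling in ribbon categories *)

(** The transpose of [f], bent with the cup of A and the cap of B. As a module transformation it
    comes from one morphism [g], and so slides along cups and caps at every W. *)
Lemma dpair_mate (k : fieldType) (C : monCat k) (A B : C) (P : dpair A) (Q : dpair B)
    (f : hom A B) :
  exists g : hom (dob Q) (dob P), forall W,
    (f ▷ (dob P ⊗ W)) ∘ cof P W = (B ◁ (g ▷ W)) ∘ cof Q W /\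
    evf P W ∘ (g ▷ (A ⊗ W)) = evf Q W ∘ (dob Q ◁ (f ▷ W)).
Proof.
pose gf W := evf Q (dob P ⊗ W) ∘ (dob Q ◁ ((f ▷ (dob P ⊗ W)) ∘ cof P W)).
have [g gE] : exists g : hom (dob Q) (dob P), forall W, gf W = g ▷ W.
  apply: wtrans_rep; apply: (wtrans_comp (t := [:: dob Q; B; dob P])).
    exact: (evf_wtrans Q [:: dob P]).
  apply: (@wtrans_l _ _ (dob Q) [::] [:: B; dob P]).
  apply: (wtrans_comp (t := [:: A; dob P])); last exact: (cof_wtrans P [::]).
  exact: (wtrans_mor f [:: dob P]).
exists g => W; split.
  rewrite -gE /gf lwhisk_comp -compA -cof_nat compA.
  by rewrite zig1 comp1m.
rewrite -gE /gf compA -evf_nat -!compA -lwhisk_comp compA whiskC -compA zig1.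
by rewrite compm1.
Qed.

Section Ribbon.
Variables (k : fieldType) (C : ribbonCat k).
Implicit Types A B W X Y Z V : C.

Definition brf X Y W : hom (X ⊗ (Y ⊗ W)) (Y ⊗ (X ⊗ W)) :=
  locked (assoc Y X W ∘ (braid X Y ▷ W) ∘ associ X Y W).

Lemma brfE X Y W : brf X Y W = assoc Y X W ∘ (braid X Y ▷ W) ∘ associ X Y W.
Proof. by rewrite /brf -lock. Qed.

Lemma brf_wtrans X Y u :
  @wtrans _ _ [:: X, Y & u] [:: Y, X & u] (fun W => brf X Y (wob u W)).
Proof.
apply: (@eq_wtrans _ _ [:: X, Y & u] [:: Y, X & u] _ _ (fun W => esym (brfE X Y (wob u W)))).
apply: (wtrans_comp (t := X ⊗ Y :: u)); last exact: wtrans_associ.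
apply: (wtrans_comp (t := Y ⊗ X :: u)); last exact: wtrans_mor.
exact: wtrans_assoc.
Qed.

Lemma brf_nat X Y W W' (h : hom W W') :
  brf X Y W' ∘ (X ◁ (Y ◁ h)) = (Y ◁ (X ◁ h)) ∘ brf X Y W.
Proof. exact: (brf_wtrans X Y [::]).1. Qed.

Lemma brf_natl X X' Y W (f : hom X X') :
  brf X' Y W ∘ (f ▷ (Y ⊗ W)) = (Y ◁ (f ▷ W)) ∘ brf X Y W.
Proof.
rewrite !brfE -(tensm_id Y W) -!compA associ_nat.
rewrite (reassoc (esym (assoc_nat _ _ _))); congr (_ ∘ _).
by rewrite !compA -!rwhisk_comp braid_nat.
Qed.

Lemma brf_natr X Y Y' W (g : hom Y Y') :
  brf X Y' W ∘ (X ◁ (g ▷ W)) = (g ▷ (X ⊗ W)) ∘ brf X Y W.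
Proof.
rewrite !brfE -(tensm_id X W) -!compA associ_nat.
rewrite (reassoc (esym (assoc_nat _ _ _))); congr (_ ∘ _).
by rewrite !compA -!rwhisk_comp braid_nat.
Qed.

Lemma pentagon_r (X Y Z W : C) :
  assoc (X ⊗ Y) Z W ∘ (associ X Y Z ▷ W) =
  associ X Y (Z ⊗ W) ∘ (X ◁ assoc Y Z W) ∘ assoc X (Y ⊗ Z) W.
Proof.
apply: (comp_cancel_r (rwhiskK W (associK X Y Z))).
rewrite -!compA rwhiskK ?assocK // compm1.
have := pentagon X Y Z W; rewrite -!compA => ->.
by rewrite compA assocK comp1m.
Qed.

Lemma pentagon_l (X Y Z W : C) :
  assoc X (Y ⊗ Z) W ∘ (assoc X Y Z ▷ W) ∘ associ (X ⊗ Y) Z W =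
  (X ◁ associ Y Z W) ∘ assoc X Y (Z ⊗ W).
Proof.
apply: (comp_cancel_l (lwhiskK X (assocK Y Z W))).
rewrite (reassoc1 (lwhiskK X (associK Y Z W))) comp1m.
by rewrite !compA pentagon -compA associK compm1.
Qed.

Lemma hexagon1f X Y Z W :
  assoc Y Z (X ⊗ W) ∘ brf X (Y ⊗ Z) W =
  (Y ◁ brf X Z W) ∘ brf X Y (Z ⊗ W) ∘ (X ◁ assoc Y Z W).
Proof.
apply: (comp_cancel_r (associK X (Y ⊗ Z) W)).
have hex : assoc Y Z X ∘ braid X (Y ⊗ Z) =
    (idm Y ⊗m braid X Z) ∘ assoc Y X Z ∘ (braid X Y ⊗m idm Z) ∘ associ X Y Z.
  by rewrite -hexagon1 -compA associK compm1.
rewrite !brfE !lwhisk_comp -!compA.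
rewrite assocK compm1.
have := pentagon_r X Y Z W; rewrite -!compA => <-.
have e1 : (braid X Y ▷ (Z ⊗ W)) ∘ assoc _ Z W = assoc _ Z W ∘ ((braid X Y ▷ Z) ▷ W).
  by rewrite assoc_nat tensm_id.
rewrite (reassoc e1).
have := pentagon Y X Z W; rewrite -!compA => e2.
rewrite (compA (assoc Y X (Z ⊗ W))) -e2 -!compA.
rewrite (reassoc1 (lwhiskK Y (assocK X Z W))) comp1m.
rewrite (reassoc (esym (assoc_nat _ _ _))).
have := pentagon Y Z X W; rewrite -!compA => e3.
rewrite (compA (assoc Y Z (X ⊗ W))) -e3 -!compA.
congr (_ ∘ (_ ∘ _)).
by rewrite -!rwhisk_comp compA hex !compA.
Qed.

Lemma hexagon2f X Y Z W :
  (Z ◁ assoc X Y W) ∘ brf (X ⊗ Y) Z W =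
  brf X Z (Y ⊗ W) ∘ (X ◁ brf Y Z W) ∘ assoc X Y (Z ⊗ W).
Proof.
have hex : braid (X ⊗ Y) Z =
    assoc Z X Y ∘ (braid X Z ▷ Y) ∘ associ X Z Y ∘ (X ◁ braid Y Z) ∘ assoc X Y Z.
  have := hexagon2 X Y Z; move=> /(congr1 (fun h => assoc Z X Y ∘ h ∘ assoc X Y Z)).
  rewrite -!compA assocK compm1 (reassoc1 (associK Z X Y)) comp1m => ->.
  by rewrite !compA.
rewrite !brfE !lwhisk_comp hex !rwhisk_comp -!compA.
have := pentagon Z X Y W; rewrite -!compA => e1.
have -> : forall h : hom _ (Z ⊗ X ⊗ Y ⊗ W),
    (Z ◁ assoc X Y W) ∘ (assoc Z (X ⊗ Y) W ∘ ((assoc Z X Y ▷ W) ∘ h)) =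
    assoc Z X (Y ⊗ W) ∘ (assoc (Z ⊗ X) Y W ∘ h).
  by move=> V h; have /(congr1 (fun g => g ∘ h)) := e1; rewrite -!compA.
rewrite (reassoc (assoc_nat _ _ _)) tensm_id.
have e2 := pentagon_r X Z Y W.
rewrite (reassoc e2) -!compA (reassoc (assoc_nat _ _ _)).
have := pentagon_l X Y Z W; rewrite -!compA => ->.
by [].
Qed.

(** Put u for the left side. The hexagon at X, 1, 1 gives u ∘ (u ▷ 1) = u ∘ (runit X ▷ 1), and u is
    invertible. *)
Lemma braid_unit X : lunit X ∘ braid X munit = runit X.
Proof.
have [bi [biK bKi]] := braid_iso X munit.
have lbK : bi ∘ luniti X ∘ (lunit X ∘ braid X munit) = idm _.
  by rewrite -compA (compA (luniti X)) lunitK comp1m biK.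
apply: runit_faithful; apply: (comp_cancel_l lbK).
have := hexagon1 X munit munit.
move=> /(congr1 (fun h => lunit X ∘ (munit ◁ lunit X) ∘ h)).
rewrite -!compA (reassoc1 (triangle munit X)) -lunit_runit.
have e := braid_nat (idm X) (lunit (munit : C)).
rewrite (reassoc (esym e)) triangle => ->.
rewrite (reassoc1 (esym (lwhisk_comp _ _ _))) (reassoc (lunit_nat _)).
by rewrite (reassoc1 (lunit_tens _ _)) -rwhisk_comp !compA.
Qed.

Lemma brf_unit X W : lunit (X ⊗ W) ∘ brf X munit W = X ◁ lunit W.
Proof.
rewrite !brfE !compA lunit_tens -rwhisk_comp braid_unit -triangle.
by rewrite -compA associK compm1.
Qed.

(** Naturality of the braiding in [p]: a strand crossing both legs of a cap can be pulled off,
    because crossing the unit is trivial. *)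
Lemma brf_pairf A B Z W (p : hom (A ⊗ B) munit) :
  pairf p (Z ⊗ W) ∘ ((A ◁ brf Z B W) ∘ brf Z A (B ⊗ W)) = Z ◁ pairf p W.
Proof.
apply: (comp_cancel_r (lwhiskK Z (associK A B W))).
have := hexagon1f Z A B W; rewrite -!compA => <-.
rewrite !pairfE -!compA (reassoc1 (assocK A B (Z ⊗ W))) comp1m.
rewrite -brf_natr (reassoc1 (brf_unit Z W)) -!lwhisk_comp -!compA.
by rewrite assocK compm1.
Qed.

(** The cap on the other side, X ⊗ X^* -> 1, obtained from braiding and twist for an arbitrary dual
    of X. *)
Definition evt X (P : dpair X) W : hom (X ⊗ (dob P ⊗ W)) W :=
  locked (evf P W ∘ brf X (dob P) W ∘ (twist X ▷ (dob P ⊗ W))).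

Lemma evtE X (P : dpair X) W :
  evt P W = evf P W ∘ brf X (dob P) W ∘ (twist X ▷ (dob P ⊗ W)).
Proof. by rewrite /evt -lock. Qed.

Lemma evt_mate A B (P : dpair A) (Q : dpair B) (f : hom A B)
    (g : hom (dob Q) (dob P)) W :
  evf P W ∘ (g ▷ (A ⊗ W)) = evf Q W ∘ (dob Q ◁ (f ▷ W)) ->
  evt P W ∘ (A ◁ (g ▷ W)) = evt Q W ∘ (f ▷ (dob Q ⊗ W)).
Proof.
move=> fg; rewrite !evtE -!compA -whiskC (reassoc (brf_natr _ _ _)).
rewrite (reassoc fg) -(reassoc (brf_natl _ _ _)).
by rewrite -!rwhisk_comp twist_nat.
Qed.

(* Partial trace over A, the strands of the word p standing to its left. *)
Definition ptr p A (P : dpair A)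
    (h : forall W, hom (wob p (A ⊗ W)) (wob p (A ⊗ W))) W : hom (wob p W) (wob p W) :=
  wmap p (evt P W) ∘ h (dob P ⊗ W) ∘ wmap p (cof P W).

(** Cyclicity: [f] travels around the loop as its mate. With [f] an identity this says that the
    partial trace does not depend on the chosen dual. *)
Lemma ptr_cycle p A B (P : dpair A) (Q : dpair B) (f : hom A B)
    (h : forall W, hom (wob p (B ⊗ W)) (wob p (A ⊗ W))) W :
  (forall W W' (j : hom W W'), h W' ∘ wmap p (B ◁ j) = wmap p (A ◁ j) ∘ h W) ->
  ptr P (fun W => h W ∘ wmap p (f ▷ W)) W = ptr Q (fun W => wmap p (f ▷ W) ∘ h W) W.
Proof.
move=> hnat; have [g gP] := dpair_mate P Q f.
rewrite /ptr -!compA -wmap_comp (gP W).1 wmap_comp (reassoc (hnat _ _ _)).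
rewrite compA -wmap_comp (evt_mate (gP W).2).
by rewrite wmap_comp -!compA.
Qed.

Definition ldpair X : dpair X := dpair_of (ldualP X).

Notation evb X W := (evf (ldpair X) W ∘ brf X X^∨ W).

Lemma evb_pairf X W : evb X W = pairf (ev X ∘ braid X X^∨) W.
Proof.
rewrite /= !pairfE brfE rwhisk_comp -!compA.
by rewrite (reassoc1 (assocK _ _ _)) comp1m.
Qed.

Lemma brf_evb X Z W :
  evb X (Z ⊗ W) ∘ ((X ◁ brf Z X^∨ W) ∘ brf Z X (X^∨ ⊗ W)) = Z ◁ evb X W.
Proof. by rewrite !evb_pairf brf_pairf. Qed.

End Ribbon.

(** * Duals of tensor products: nested cups and caps *)

Section TensorDual.
Variables (k : fieldType) (C : monCat k) (Y Z : C) (P : dpair Y) (Q : dpair Z).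
Let D := dob Q ⊗ dob P.

Definition evf2 W : hom (D ⊗ (Y ⊗ Z ⊗ W)) W :=
  locked (evf Q W ∘ (dob Q ◁ evf P (Z ⊗ W)) ∘ assoc (dob Q) (dob P) (Y ⊗ (Z ⊗ W))
    ∘ (D ◁ assoc Y Z W)).

Lemma evf2E W : evf2 W =
  evf Q W ∘ (dob Q ◁ evf P (Z ⊗ W)) ∘ assoc (dob Q) (dob P) (Y ⊗ (Z ⊗ W))
    ∘ (D ◁ assoc Y Z W).
Proof. by rewrite /evf2 -lock. Qed.

Definition cof2 W : hom W (Y ⊗ Z ⊗ (D ⊗ W)) :=
  locked (associ Y Z (D ⊗ W) ∘ (Y ◁ (Z ◁ associ (dob Q) (dob P) W))
    ∘ (Y ◁ cof Q (dob P ⊗ W)) ∘ cof P W).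

Lemma cof2E W : cof2 W =
  associ Y Z (D ⊗ W) ∘ (Y ◁ (Z ◁ associ (dob Q) (dob P) W))
    ∘ (Y ◁ cof Q (dob P ⊗ W)) ∘ cof P W.
Proof. by rewrite /cof2 -lock. Qed.

Lemma evf2_wtrans u : @wtrans _ _ [:: D, Y ⊗ Z & u] u (fun W => evf2 (wob u W)).
Proof.
apply: (@eq_wtrans _ _ [:: D, Y ⊗ Z & u] u _ _ (fun W => esym (evf2E (wob u W)))).
apply: (wtrans_comp (t := [:: D, Y, Z & u])).
  apply: (wtrans_comp (t := [:: dob Q, dob P, Y, Z & u])); last exact: wtrans_assoc.
  apply: (wtrans_comp (t := [:: dob Q, Z & u])); first exact: evf_wtrans.
  apply: (@wtrans_l _ _ (dob Q) [:: dob P, Y, Z & u] (Z :: u)).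
  exact: (evf_wtrans P (Z :: u)).
by apply: (@wtrans_l _ _ D [:: Y ⊗ Z & u] [:: Y, Z & u]); exact: wtrans_assoc.
Qed.

Lemma cof2_wtrans u : @wtrans _ _ u [:: Y ⊗ Z, D & u] (fun W => cof2 (wob u W)).
Proof.
apply: (@eq_wtrans _ _ u [:: Y ⊗ Z, D & u] _ _ (fun W => esym (cof2E (wob u W)))).
apply: (wtrans_comp (t := [:: Y, dob P & u])); last exact: cof_wtrans.
apply: (wtrans_comp (t := [:: Y, Z, dob Q, dob P & u])).
  apply: (wtrans_comp (t := [:: Y, Z, D & u])); first exact: (wtrans_associ Y Z (D :: u)).
  apply: (@wtrans_l _ _ Y [:: Z, dob Q, dob P & u] [:: Z, D & u]).
  apply: (@wtrans_l _ _ Z [:: dob Q, dob P & u] [:: D & u]).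
  exact: wtrans_associ.
apply: (@wtrans_l _ _ Y [:: dob P & u] [:: Z, dob Q, dob P & u]).
exact: (cof_wtrans Q (dob P :: u)).
Qed.

Lemma evf2_associ W : evf2 W ∘ associ (dob Q) (dob P) (Y ⊗ Z ⊗ W) =
  evf Q W ∘ (dob Q ◁ (evf P (Z ⊗ W) ∘ (dob P ◁ assoc Y Z W))).
Proof.
rewrite evf2E -!compA -(tensm_id (dob Q) (dob P)) -associ_nat.
by rewrite (reassoc1 (associK _ _ _)) comp1m lwhisk_comp.
Qed.

Lemma zig1_tens W : ((Y ⊗ Z) ◁ evf2 W) ∘ cof2 (Y ⊗ Z ⊗ W) = idm _.
Proof.
rewrite cof2E -!compA -(tensm_id Y Z) (reassoc (esym (associ_nat _ _ _))).
rewrite (reassoc1 (esym (lwhisk_comp _ _ _))) -lwhisk_comp evf2_associ.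
rewrite (reassoc1 (esym (lwhisk_comp _ _ _))) (lwhisk_comp Z) -compA -cof_nat.
rewrite (reassoc1 (zig1 _ _)) comp1m lwhisk_comp -compA -cof_nat.
by rewrite (reassoc1 (zig1 _ _)) comp1m assocK.
Qed.

Lemma zig2_tens W : evf2 (D ⊗ W) ∘ (D ◁ cof2 W) = idm _.
Proof.
rewrite evf2E cof2E !lwhisk_comp -!compA (reassoc1 (lwhiskK _ (associK _ _ _))) comp1m.
have e V V' (h : hom V V') : assoc (dob Q) (dob P) V' ∘ (D ◁ h) =
    (dob Q ◁ (dob P ◁ h)) ∘ assoc (dob Q) (dob P) V.
  by rewrite -assoc_nat tensm_id.
rewrite !(reassoc (e _ _ _)) e !(reassoc1 (esym (lwhisk_comp (dob Q) _ _))).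
rewrite evf_nat -[in (_ ∘ _) ∘ (_ ◁ (_ ◁ _))]compA evf_nat.
rewrite -!compA zig2 compm1 lwhisk_comp -compA (reassoc (evf_nat _ _)).
by rewrite (reassoc1 (zig2 _ _)) comp1m assocK.
Qed.

Definition dpair_tens : dpair (Y ⊗ Z) :=
  DPair evf2_wtrans cof2_wtrans zig1_tens zig2_tens.

End TensorDual.

(** * Loops around a strand and the Hopf link *)

Section Encircling.
Variables (k : fieldType) (C : ribbonCat k).
Implicit Types A B W X Y Z V : C.

Notation evb X W := (evf (ldpair X) W ∘ brf X X^∨ W).

(* The four crossings of Y ⊗ Z with Z^∨ ⊗ Y^∨ are undone by the double
   braiding contained in the twist of Y ⊗ Z. *)
Lemma evt_tens Y Z W :
  evt (dpair_tens (ldpair Y) (ldpair Z)) W =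
  evt (ldpair Y) W ∘ (Y ◁ evt (ldpair Z) (Y^∨ ⊗ W)) ∘ assoc Y Z (Z^∨ ⊗ (Y^∨ ⊗ W))
    ∘ ((Y ⊗ Z) ◁ assoc Z^∨ Y^∨ W).
Proof.
have [bi [biK bKi]] := braid_iso Z Y.
(* Pulling Z off the cap of Y needs a crossing of Z with Y that is absent here, so its inverse [bi]
   appears. It will cancel one half of the double braiding in [twist_tens]; the other half is used
   by [under]. *)
have over : evb Y (Z ⊗ W) ∘ ((Y ◁ brf Z Y^∨ W) ∘ assoc Y Z (Y^∨ ⊗ W)) =
    (Z ◁ evb Y W) ∘ (assoc Z Y (Y^∨ ⊗ W) ∘ (bi ▷ (Y^∨ ⊗ W))).
  apply: (comp_cancel_r (rwhiskK (Y^∨ ⊗ W) bKi)).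
  rewrite -!compA rwhiskK // compm1.
  apply: (comp_cancel_r (assocK Z Y (Y^∨ ⊗ W))).
  by rewrite -!compA associK compm1 -brf_evb !brfE -!compA.
have under V : evb Z (Y ⊗ V) ∘ ((Z ◁ brf Y Z^∨ V) ∘
      (assoc Z Y (Z^∨ ⊗ V) ∘ (braid Y Z ▷ (Z^∨ ⊗ V)))) =
    (Y ◁ evb Z V) ∘ assoc Y Z (Z^∨ ⊗ V).
  apply: (comp_cancel_r (assocK Y Z (Z^∨ ⊗ V))).
  by rewrite -[RHS]compA associK compm1 -brf_evb !brfE -!compA.
rewrite !evtE -[evf (dpair_tens _ _) W]/(evf2 (ldpair Y) (ldpair Z) W) evf2E -!compA.
have e1 : assoc Z^∨ Y^∨ (Y ⊗ (Z ⊗ W)) ∘ ((Z^∨ ⊗ Y^∨) ◁ assoc Y Z W) =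
   (Z^∨ ◁ (Y^∨ ◁ assoc Y Z W)) ∘ assoc Z^∨ Y^∨ (Y ⊗ Z ⊗ W).
  by rewrite -assoc_nat tensm_id.
rewrite (reassoc e1) (reassoc (hexagon1f _ _ _ _)) -!compA whiskC.
have e2 : evf (ldpair Y) (Z ⊗ W) ∘ ((Y^∨ ◁ assoc Y Z W) ∘ brf (Y ⊗ Z) Y^∨ W) =
    (Z ◁ evb Y W) ∘ (assoc Z Y (Y^∨ ⊗ W) ∘ (bi ▷ (Y^∨ ⊗ W))).
  by rewrite hexagon2f -over -!compA.
rewrite (reassoc1 (esym (lwhisk_comp Z^∨ _ _))) (reassoc1 (esym (lwhisk_comp Z^∨ _ _))).
rewrite e2 !(lwhisk_comp Z^∨).
rewrite -!compA (reassoc (evf_nat _ _)).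
rewrite -(reassoc (brf_natl _ _ _)) (reassoc (hexagon2f _ _ _ _)) -!compA.
rewrite (reassoc1 (esym (rwhisk_comp _ _ _))) twist_tens.
rewrite -(compA (braid Z Y)) (compA bi) biK comp1m rwhisk_comp -!compA.
have u2 V T (h : hom T _) : evf (ldpair Z) (Y ⊗ V) ∘ (brf Z Z^∨ (Y ⊗ V) ∘
      ((Z ◁ brf Y Z^∨ V) ∘ (assoc Z Y (Z^∨ ⊗ V) ∘ ((braid Y Z ▷ (Z^∨ ⊗ V)) ∘ h)))) =
    (Y ◁ evb Z V) ∘ (assoc Y Z (Z^∨ ⊗ V) ∘ h).
  by have := congr1 (fun g => g ∘ h) (under V); rewrite -!compA.
rewrite u2.
rewrite (reassoc (assoc_nat _ _ _)) (tensmE (twist Y)) -!compA.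
by rewrite (reassoc (whiskC _ _)) !lwhisk_comp -!compA.
Qed.

Lemma ptr_tens p Y Z (h : forall W, hom (wob p (Y ⊗ Z ⊗ W)) (wob p (Y ⊗ Z ⊗ W))) W :
  (forall W W' (j : hom W W'),
     h W' ∘ wmap p ((Y ⊗ Z) ◁ j) = wmap p ((Y ⊗ Z) ◁ j) ∘ h W) ->
  ptr (ldpair (Y ⊗ Z)) h W =
  wmap p (evt (ldpair Y) W ∘ (Y ◁ evt (ldpair Z) (Y^∨ ⊗ W)))
    ∘ (wmap p (assoc Y Z (Z^∨ ⊗ (Y^∨ ⊗ W))) ∘ h (Z^∨ ⊗ (Y^∨ ⊗ W))
         ∘ wmap p (associ Y Z (Z^∨ ⊗ (Y^∨ ⊗ W))))
    ∘ wmap p ((Y ◁ cof (ldpair Z) (Y^∨ ⊗ W)) ∘ cof (ldpair Y) W).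
Proof.
move=> hnat.
pose P := dpair_tens (ldpair Y) (ldpair Z).
(* Trade the given dual of Y ⊗ Z for Z^∨ ⊗ Y^∨, by cyclicity at the identity. *)
have -> : ptr (ldpair (Y ⊗ Z)) h W = ptr P h W.
  have wid V : wmap p (idm (Y ⊗ Z) ▷ V) = idm _ :> hom (wob p (Y ⊗ Z ⊗ V)) _.
    by rewrite tensm_id; elim: (p) => //= X s ->; rewrite tensm_id.
  have := @ptr_cycle _ _ p _ _ (ldpair (Y ⊗ Z)) P (idm _) h W hnat.
  by rewrite /ptr !wid compm1 comp1m.
rewrite /ptr evt_tens -[cof P W]/(cof2 (ldpair Y) (ldpair Z) W) cof2E.
have -> : associ Y Z (dob P ⊗ W) ∘ (Y ◁ (Z ◁ associ Z^∨ Y^∨ W)) =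
    ((Y ⊗ Z) ◁ associ Z^∨ Y^∨ W) ∘ associ Y Z (Z^∨ ⊗ (Y^∨ ⊗ W)).
  by rewrite associ_nat tensm_id.
have aK : wmap p ((Y ⊗ Z) ◁ assoc Z^∨ Y^∨ W) ∘ wmap p ((Y ⊗ Z) ◁ associ Z^∨ Y^∨ W)
    = idm _.
  rewrite -wmap_comp lwhiskK ?associK //.
  by elim: (p) => //= X s ->; rewrite tensm_id.
by rewrite !wmap_comp -!compA (reassoc (hnat _ _ _)) (reassoc1 aK) comp1m.
Qed.

Definition encircle Z X W : hom (X ⊗ W) (X ⊗ W) :=
  ptr (p := [:: X]) (ldpair Z) (fun W => brf Z X W ∘ brf X Z W) W.

Lemma encircleE Z X W : encircle Z X W =
  (X ◁ evt (ldpair Z) W) ∘ (brf Z X (Z^∨ ⊗ W) ∘ brf X Z (Z^∨ ⊗ W))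
    ∘ (X ◁ cof (ldpair Z) W).
Proof. by []. Qed.

(** A loop coloured Y ⊗ Z is a pair of concentric loops. Once the inner one is a scalar it can be
    taken out, which makes the encircling scalars multiplicative. *)
Lemma encircle_tens Y Z X W : encircle (Y ⊗ Z) X W =
  (X ◁ evt (ldpair Y) W) ∘ (brf Y X (Y^∨ ⊗ W) ∘ (Y ◁ encircle Z X (Y^∨ ⊗ W))
    ∘ brf X Y (Y^∨ ⊗ W)) ∘ (X ◁ cof (ldpair Y) W).
Proof.
rewrite /encircle ptr_tens; last first.
  by move=> V V' j /=; rewrite -compA brf_nat compA brf_nat compA.
rewrite /ptr /=.
have -> V : (X ◁ assoc Y Z V) ∘ (brf (Y ⊗ Z) X V ∘ brf X (Y ⊗ Z) V)
    ∘ (X ◁ associ Y Z V) =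
    brf Y X (Z ⊗ V) ∘ ((Y ◁ (brf Z X V ∘ brf X Z V)) ∘ brf X Y (Z ⊗ V)).
  apply: (comp_cancel_r (lwhiskK X (associK Y Z V))).
  rewrite -compA lwhiskK ?assocK // compm1 compA hexagon2f.
  by rewrite -!compA hexagon1f lwhisk_comp -!compA.
rewrite !lwhisk_comp -!compA; congr (_ ∘ _).
by rewrite (reassoc (esym (brf_nat _ _ _))) (reassoc (brf_nat X Y _)).
Qed.

(** Cut the loop with idm Z = \sum_i inj i ∘ prj i and turn [prj i] around it until it meets
    [inj i]. *)
Lemma encircle_direct_sum n (S : 'I_n -> C) Z X W : is_direct_sum S Z ->
  encircle Z X W = \sum_i encircle (S i) X W.
Proof.
move=> [inj [prj [pi1 pi0 pisum]]].
pose h i V := (X ◁ (inj i ▷ V)) ∘ (brf (S i) X V ∘ brf X (S i) V).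
have sumE V : brf Z X V ∘ brf X Z V = \sum_i h i V ∘ (X ◁ (prj i ▷ V)).
  under eq_bigr => i _.
    rewrite /h -!compA brf_natr (reassoc (esym (brf_natl _ _ _))).
    rewrite (reassoc1 (esym (rwhisk_comp _ _ _))); over.
  by rewrite -comp_sumr -comp_suml -tensm_suml pisum tensm_id comp1m.
rewrite encircleE sumE comp_sumr comp_suml; apply: eq_bigr => i _.
have := @ptr_cycle _ _ [:: X] _ _ (ldpair Z) (ldpair (S i)) (prj i) (h i) W.
rewrite {1}/ptr /= => -> => [|V V' j].
  rewrite /encircle /ptr /= /h; congr (_ ∘ _ ∘ _).
  by rewrite compA -lwhisk_comp -rwhisk_comp pi1 !tensm_id comp1m.
rewrite /h -!compA brf_nat (reassoc (brf_nat _ _ _)) !compA.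
by rewrite -!lwhisk_comp whiskC.
Qed.

(** With [wtrans_rep], the loop becomes an endomorphism of X alone, hence a scalar when X is
    simple. *)
Lemma encircle_wtrans Z X : @wtrans _ _ [:: X] [:: X] (encircle Z X).
Proof.
apply: (wtrans_comp (t := [:: X; Z; Z^∨])); last first.
  apply: (@wtrans_l _ _ X [::] [:: Z; Z^∨]); exact: (cof_wtrans (ldpair Z) [::]).
apply: (wtrans_comp (t := [:: X; Z; Z^∨])).
  apply: (@wtrans_l _ _ X [:: Z; Z^∨] [::]).
  apply: (@eq_wtrans _ _ [:: Z; Z^∨] [::] _ _ (fun W => esym (evtE (ldpair Z) W))).
  apply: (wtrans_comp (t := [:: Z; Z^∨])); last exact: (wtrans_mor _ [:: Z^∨]).
  apply: (wtrans_comp (t := [:: Z^∨; Z])); last exact: (brf_wtrans Z Z^∨ [::]).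
  exact: (evf_wtrans (ldpair Z) [::]).
apply: (wtrans_comp (t := [:: Z; X; Z^∨])); exact: (brf_wtrans _ _ [:: Z^∨]).
Qed.

Lemma pairf_unit A B (p : hom (A ⊗ B) munit) :
  pairf p munit = p ∘ (A ◁ runit B).
Proof.
rewrite pairfE lunit_runit runit_nat -runit_tens -!compA associK.
by rewrite compm1.
Qed.

Lemma copairf_unit A B (c : hom munit (A ⊗ B)) :
  (A ◁ runit B) ∘ copairf c munit = c.
Proof.
rewrite copairfE !compA runit_tens runit_nat -lunit_runit.
by rewrite -compA lunitiK compm1.
Qed.

Lemma qtraceE A (f : hom A A) :
  qtrace f = scalar_of (ptr (p := [::]) (ldpair A) (fun W => f ▷ W) munit).
Proof.
rewrite /qtrace; congr scalar_of; rewrite /ptr /= evtE [evb _ _]evb_pairf pairf_unit.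
rewrite -{1}(copairf_unit (coev A)) rwhisk_comp -!compA.
by rewrite (reassoc (whiskC _ _)) (reassoc (whiskC f _)).
Qed.

Lemma qtrace_cycle A B (f : hom A B) (g : hom B A) : qtrace (g ∘ f) = qtrace (f ∘ g).
Proof.
rewrite !qtraceE; congr scalar_of.
have := @ptr_cycle _ _ [::] _ _ (ldpair A) (ldpair B) f (fun W => g ▷ W) munit.
rewrite /ptr /= -!rwhisk_comp => -> // V V' j; exact/esym/whiskC.
Qed.

Lemma scalar_ofZ c (f : hom (munit : C) munit) : scalar_of (c *: f) = c * scalar_of f.
Proof. by rewrite /scalar_of linearZ. Qed.

(** By [qtraceE] this is the ribbon trace of the identity. *)
Definition qdim X := scalar_of (evt (ldpair X) munit ∘ cof (ldpair X) munit).

(** The left side is the Hopf link. Tracing out Z first leaves a loop around Y, that is [c], and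
    closing Y then gives its dimension. *)
Lemma qtrace_braid Y Z c : (forall W, encircle Z Y W = c *: idm _) ->
  qtrace (braid Z Y ∘ braid Y Z) = c * qdim Y.
Proof.
move=> cE; rewrite qtraceE -scalar_ofZ; congr scalar_of.
rewrite ptr_tens => [|V V' j]; last exact/esym/whiskC.
rewrite /= rwhisk_comp.
have -> V : assoc Y Z V ∘ ((braid Z Y ▷ V) ∘ (braid Y Z ▷ V)) ∘ associ Y Z V =
    brf Z Y V ∘ brf Y Z V.
  by rewrite !brfE -!compA (reassoc1 (assocK _ _ _)) comp1m.
have := congr1 (fun g => g ∘ cof (ldpair Y) munit) (cE (Y^∨ ⊗ munit)).
rewrite encircleE -!compA => ->.
by rewrite compZl comp1m compZr.
Qed.

End Encircling.

(** * The Grothendieck ring *)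

Section Dimensions.
Variable k : fieldType.

Lemma lfun_of_linear (U V : vectType k) (f : U -> V) : linear f ->
  exists F : 'Hom(U, V), F =1 f.
Proof.
move=> flin.
pose fl : {linear U -> V} := HB.pack f (GRing.isLinear.Build k U V *:%R f flin).
by exists (linfun fl) => u; rewrite lfunE.
Qed.

Lemma dim_direct_sum (I : finType) (V : I -> vectType k) (U : vectType k)
    (a : forall i, V i -> U) (b : forall i, U -> V i) :
  (forall i, linear (a i)) -> (forall i, linear (b i)) ->
  (forall i x, b i (a i x) = x) -> (forall i j x, i <> j -> b i (a j x) = 0) ->
  (forall u, \sum_i a i (b i u) = u) ->
  \dim {: U} = (\sum_i \dim {: V i})%N.
Proof.
move=> alin blin ba1 ba0 abu.
pose A i := sval (cid (lfun_of_linear (alin i))).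
have AE i : A i =1 a i := svalP (cid (lfun_of_linear (alin i))).
pose B i := sval (cid (lfun_of_linear (blin i))).
have BE i : B i =1 b i := svalP (cid (lfun_of_linear (blin i))).
have fullE : fullv = (\sum_i (A i @: fullv))%VS.
  apply/eqP; rewrite eqEsubv subvf andbT; apply/subvP => u _.
  rewrite -(abu u); apply: memv_suml => i _; apply: (subvP (sumv_sup i _ (subvv _))) => //.
  by rewrite -AE memv_img ?memvf.
have dirA : directv (\sum_i (A i @: fullv)).
  apply/directv_sum_independent => us usA us0 i _.
  have Bus j : j != i -> B i (us j) = 0.
    by move=> /eqP ji; have [y _ ->] := memv_imgP (usA j isT); rewrite BE AE ba0 // => /esym.
  have := congr1 (B i) us0; rewrite linear0 linear_sum (bigD1 i) //= big1 // addr0.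
  by have [y _ ->] := memv_imgP (usA i isT); rewrite BE AE ba1 => ->; rewrite -AE linear0.
rewrite fullE (directvP dirA); apply: eq_bigr => i _.
apply: limg_dim_eq; apply/eqP; rewrite capfv -subv0; apply/subvP => x.
by rewrite memv_ker AE => /eqP x0; rewrite -(ba1 i x) x0 -BE linear0 mem0v.
Qed.

Lemma dim_linear_bij (U V : vectType k) (f : U -> V) (g : V -> U) :
  linear f -> linear g -> cancel f g -> cancel g f -> \dim {: U} = \dim {: V}.
Proof.
move=> flin glin fK gK.
rewrite (@dim_direct_sum unit (fun _ => U) V (fun _ => f) (fun _ => g)) //.
- by rewrite (big_pred1 tt) // => -[].
- by move=> [] [].
- by move=> v; rewrite (big_pred1 tt) // => -[].
Qed.

Lemma dimv_eq0P (U : vectType k) : reflect (forall u : U, u = 0) (\dim {: U} == 0%N).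
Proof.
apply: (iffP eqP) => [/eqP | U0].
  by rewrite dimv_eq0 => /eqP U0 u; apply/eqP; rewrite -memv0 -U0 memvf.
by apply/eqP; rewrite dimv_eq0 -subv0; apply/subvP => u _; rewrite (U0 u) mem0v.
Qed.

Variable C : linCat k.
Implicit Types X Y Z : C.

Lemma dim_hom_sum_r n (S : 'I_n -> C) X Y : is_direct_sum S Y ->
  \dim {: hom X Y} = (\sum_i \dim {: hom X (S i)})%N.
Proof.
move=> [inj [prj [pi1 pi0 pisum]]].
apply: (@dim_direct_sum _ (fun i => hom X (S i)) _
   (fun i h => inj i ∘ h) (fun i h => prj i ∘ h)).
- by move=> i a g h; rewrite compDr compZr.
- by move=> i a g h; rewrite compDr compZr.
- by move=> i h; rewrite compA pi1 comp1m.
- by move=> i j h ij; rewrite compA pi0 // comp0l.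
- by move=> h; under eq_bigr do rewrite compA; rewrite -comp_suml pisum comp1m.
Qed.

Lemma dim_hom_sum_l n (S : 'I_n -> C) X Y : is_direct_sum S Y ->
  \dim {: hom Y X} = (\sum_i \dim {: hom (S i) X})%N.
Proof.
move=> [inj [prj [pi1 pi0 pisum]]].
apply: (@dim_direct_sum _ (fun i => hom (S i) X) _
   (fun i h => h ∘ prj i) (fun i h => h ∘ inj i)).
- by move=> i a g h; rewrite compDl compZl.
- by move=> i a g h; rewrite compDl compZl.
- by move=> i h; rewrite -compA pi1 compm1.
- by move=> i j h ij; rewrite -compA pi0 ?comp0r // => /esym.
- by move=> h; under eq_bigr do rewrite -compA; rewrite -comp_sumr pisum compm1.
Qed.

Lemma isomorphic_refl X : isomorphic X X.
Proof. by exists (idm X), (idm X); rewrite comp1m. Qed.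

Lemma isomorphic_sym X Y : isomorphic X Y -> isomorphic Y X.
Proof. by move=> [f [g [gf fg]]]; exists g, f. Qed.

Lemma isomorphic_trans X Y Z : isomorphic X Y -> isomorphic Y Z -> isomorphic X Z.
Proof.
move=> [f [f' [f'f ff']]] [g [g' [g'g gg']]]; exists (g ∘ f), (f' ∘ g').
by rewrite -!compA (reassoc1 g'g) (reassoc1 ff') !comp1m.
Qed.

Lemma isomorphic_direct_sum X Y : isomorphic X Y -> is_direct_sum (fun _ : 'I_1 => X) Y.
Proof.
move=> [f [g [gf fg]]]; exists (fun _ => f), (fun _ => g); split=> [//|i j|].
  by rewrite (ord1 i) (ord1 j).
by rewrite big_ord1.
Qed.

Lemma direct_sum1 X Y (S : 'I_1 -> C) : is_direct_sum S Y -> isomorphic (S ord0) Y.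
Proof.
move=> [inj [prj [pi1 pi0 pisum]]]; exists (inj ord0), (prj ord0).
by rewrite pi1 -pisum big_ord1.
Qed.

Lemma direct_sum_iso n (S T : 'I_n -> C) Y :
  (forall i, isomorphic (S i) (T i)) -> is_direct_sum S Y -> is_direct_sum T Y.
Proof.
move=> ST [inj [prj [pi1 pi0 pisum]]].
pose f i := sval (cid (ST i)); have fP i : is_iso (f i) := svalP (cid (ST i)).
pose g i := sval (cid (fP i)).
have gP i : g i ∘ f i = idm _ /\ f i ∘ g i = idm _ := svalP (cid (fP i)).
exists (fun i => inj i ∘ g i), (fun i => f i ∘ prj i); split=> [i|i j ij|].
- by rewrite -!compA (reassoc1 (pi1 i)) comp1m; case: (gP i).
- by rewrite -!compA (reassoc1 (pi0 _ _ ij)) comp0l comp0r.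
by rewrite -pisum; apply: eq_bigr => i _; rewrite -!compA (reassoc1 (gP i).1) comp1m.
Qed.

Lemma dim_hom_iso_r X Y Z : isomorphic Y Z -> \dim {: hom X Y} = \dim {: hom X Z}.
Proof.
by move=> /isomorphic_direct_sum YZ; rewrite (dim_hom_sum_r X YZ) big_ord1.
Qed.

Lemma dim_hom_iso_l X Y Z : isomorphic Y Z -> \dim {: hom Y X} = \dim {: hom Z X}.
Proof.
by move=> /isomorphic_direct_sum YZ; rewrite (dim_hom_sum_l X YZ) big_ord1.
Qed.

End Dimensions.

(** * Schur's lemma *)

Section Schur.
Variables (k : closedFieldType) (C : linCat k).
Hypothesis Cabelian : abelian_cat C.
Implicit Types X Y Z : C.

Lemma idm_eq0_zero X : idm X = 0 -> is_zero X.
Proof.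
move=> X0; split=> Y f; first by rewrite -[f]compm1 X0 comp0r.
by rewrite -[f]comp1m X0 comp0l.
Qed.

Lemma simple_mono X Y (f : hom X Y) : simple X -> f <> 0 -> is_mono f.
Proof.
move=> [X0 Xs] f0; have [_ ker _ _ _] := Cabelian.
have [K [i [fi0 univ]]] := ker _ _ f.
have imono : is_mono i.
  move=> Z g h igh; have fg : f ∘ (i ∘ g) = 0 by rewrite compA fi0 comp0l.
  by have [u [_ uniq]] := univ _ _ fg; rewrite -(uniq g) // -(uniq h).
case: (Xs _ i imono) => [K0|[j [_ ij]]].
  move=> Z g h fgh; apply/subr0_eq.
  have /univ [u [iu _]] : f ∘ (g - h) = 0.
    by rewrite compDr -scaleN1r compZr scaleN1r fgh subrr.
  by rewrite -iu (K0.2 _ u) comp0r.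
by case: f0; rewrite -[f]compm1 -ij compA fi0 comp0l.
Qed.

Lemma simple_iso X Y (f : hom X Y) : simple X -> simple Y -> f <> 0 -> is_iso f.
Proof.
move=> sX [Y0 Ys] f0; case: (Ys _ f (simple_mono sX f0)) => // X0.
by case: f0; exact: X0.1.
Qed.

(** Composition with [f] on the finite-dimensional space End(X) has an eigenvector u. Then f - a
    kills u != 0, so it is not mono and must vanish. *)
Lemma simple_endo X (f : hom X X) : simple X -> exists a, f = a *: idm X.
Proof.
move=> sX; have X0 : idm X <> 0 by move=> /idm_eq0_zero; case: sX.
pose n := \dim {: hom X X}; pose b := vbasis {: hom X X}.
have fullb u : u \in <<b>>%VS by rewrite (span_basis (vbasisP _)) memvf.
have n0 : (0 < n)%N.
  by rewrite lt0n; apply/negP => /dimv_eq0P h; apply: X0; exact: h.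
pose M := \matrix_(i < n, j < n) coord b j (f ∘ b`_i).
have [a] : exists a, root (char_poly M) a.
  by apply/closed_rootP; rewrite size_char_poly eqSS -lt0n.
rewrite -eigenvalue_root_char => /eigenvalueP[v vM v0].
exists a; pose u := \sum_i v 0 i *: b`_i.
have u0 : u <> 0.
  move=> u0; case/eqP: v0; apply/rowP => i; rewrite mxE.
  have /freeP bfree : free b := basis_free (vbasisP _).
  exact: (bfree (fun i => v 0 i) u0 i).
have fu : f ∘ u = a *: u.
  rewrite /u comp_sumr scaler_sumr.
  under eq_bigr => i _ do rewrite compZr (coord_span (fullb (f ∘ _))) scaler_sumr.
  rewrite exchange_big /=; apply: eq_bigr => j _.
  have := congr1 (fun w : 'rV_n => w 0 j) vM; rewrite !mxE scalerA => <-.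
  by rewrite scaler_suml; apply: eq_bigr => i _; rewrite mxE scalerA.
apply/eqP; rewrite -subr_eq0; apply/negP => /negP/eqP fa0.
apply: u0; apply: (simple_mono sX fa0).
by rewrite comp0r compDl -scaleNr compZl comp1m scaleNr fu subrr.
Qed.

Lemma dim_hom_simple X Y : simple X -> simple Y ->
  \dim {: hom X Y} = `[< isomorphic X Y >].
Proof.
move=> sX sY; case: asboolP => [XY|nXY]; last first.
  apply/eqP/dimv_eq0P => f; apply: contrapT => f0; apply: nXY.
  by exists f; exact: simple_iso.
rewrite -(dim_hom_iso_r X XY).
have X0 : idm X <> 0 by move=> /idm_eq0_zero; case: sX.
rewrite (_ : fullv = <[idm X]>%VS) ?dim_vline; first by case: eqP X0.
apply/eqP; rewrite eqEsubv subvf andbT; apply/subvP => f _.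
by have [a ->] := simple_endo f sX; rewrite memvZ ?memv_line.
Qed.

End Schur.

(* Nfrob is Frobenius reciprocity Hom(X_l, X_i X_j) = Hom(X_i^* X_l, X_j).
   With the unit laws it forces st to be the duality involution. *)
Record fusion_rules m (N : 'I_m -> 'I_m -> 'I_m -> nat) (e : 'I_m)
    (st : 'I_m -> 'I_m) : Prop := FusionRules {
  N1l : forall j l, N e j l = (j == l);
  N1r : forall i l, N i e l = (i == l);
  NA : forall i j k l,
    (\sum_a N i j a * N a k l = \sum_a N j k a * N i a l)%N;
  Nfrob : forall i j l, N i j l = N (st i) l j
}.

(** Shows that duals of simple objects are simple, with [M i j] the multiplicity of X_j in X_i^*. A
    diagonal entry of M^2 yields M i a = M a i = 1 for some a; any further nonzero entry in row i
    would make an off-diagonal entry of M^2 positive. *)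
Lemma nat_involution_perm m (M : 'I_m -> 'I_m -> nat) :
  (forall i l, (\sum_a M i a * M a l)%N = (i == l)) ->
  exists st : 'I_m -> 'I_m, forall i j, M i j = (j == st i).
Proof.
move=> M2.
have /choice [st stP] : forall i, exists a, (M i a * M a i = 1)%N.
  move=> i; apply: contrapT => /forallNP noa.
  have := M2 i i; rewrite eqxx big1 // => a _; apply/eqP.
  have : (M i a * M a i <= \sum_b M i b * M b i)%N by rewrite (bigD1 a) //= leq_addr.
  by rewrite M2 eqxx; case: (M i a * M a i)%N (noa a) => [|[|]].
exists st => i j; have /eqP := stP i; rewrite muln_eq1 => /andP[/eqP Mis /eqP Msi].
case: eqP => [-> //|/eqP jst].
have : (M (st i) i * M i j <= \sum_a M (st i) a * M a j)%N.
  by rewrite (bigD1 i) //= leq_addr.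
by rewrite M2 eq_sym (negPf jst) Msi mul1n leqn0 => /eqP.
Qed.

Section TensorSums.
Variables (k : fieldType) (C : monCat k).

Lemma direct_sum_tensl n (S : 'I_n -> C) (Y Z : C) :
  is_direct_sum S Y -> is_direct_sum (fun i => S i ⊗ Z) (Y ⊗ Z).
Proof.
move=> [inj [prj [pi1 pi0 pisum]]].
exists (fun i => inj i ▷ Z), (fun i => prj i ▷ Z); split=> [i|i j ij|].
- by rewrite -rwhisk_comp pi1 tensm_id.
- by rewrite -rwhisk_comp pi0 // tensm0l.
under eq_bigr do rewrite -rwhisk_comp.
by rewrite -tensm_suml pisum tensm_id.
Qed.

Lemma direct_sum_tensr n (S : 'I_n -> C) (Y Z : C) :
  is_direct_sum S Y -> is_direct_sum (fun i => Z ⊗ S i) (Z ⊗ Y).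
Proof.
move=> [inj [prj [pi1 pi0 pisum]]].
exists (fun i => Z ◁ inj i), (fun i => Z ◁ prj i); split=> [i|i j ij|].
- by rewrite -lwhisk_comp pi1 tensm_id.
- by rewrite -lwhisk_comp pi0 // tensm0r.
under eq_bigr do rewrite -lwhisk_comp.
by rewrite -tensm_sumr pisum tensm_id.
Qed.

Lemma isomorphic_tens (Y Y' Z Z' : C) :
  isomorphic Y Y' -> isomorphic Z Z' -> isomorphic (Y ⊗ Z) (Y' ⊗ Z').
Proof.
move=> [f [f' [f'f ff']]] [g [g' [g'g gg']]].
by exists (f ⊗m g), (f' ⊗m g'); rewrite -!tensm_comp f'f g'g ff' gg' !tensm_id.
Qed.

Lemma dim_hom_dual (A B Z : C) (P : dpair A) :
  \dim {: hom (dob P ⊗ B) Z} = \dim {: hom B (A ⊗ Z)}.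
Proof.
apply: (@dim_linear_bij _ _ _ (fun f => (A ◁ f) ∘ cof P B)
  (fun g => evf P Z ∘ (dob P ◁ g))) => [a f g|a f g|f|g].
- by rewrite tensmDr tensmZr compDl compZl.
- by rewrite tensmDr tensmZr compDr compZr.
- by rewrite lwhisk_comp compA evf_nat -compA zig2 compm1.
- by rewrite lwhisk_comp -compA -cof_nat compA zig1 comp1m.
Qed.

End TensorSums.

Section FusionRing.
Variables (R : realType) (C : fusionCat R[i]%C) (m : nat) (X : 'I_m -> C).
Hypothesis hX : simple_reps X.
Implicit Types Y Z : C.

Let Cab : abelian_cat C := fus_abelian C.

Lemma decompose Y : exists n (t : 'I_n -> 'I_m), is_direct_sum (fun i => X (t i)) Y.
Proof.
have [n [S [sS SY]]] := fus_semisimple Y.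
have [_ _ hS] := hX; have /choice [t tP] := fun i => hS _ (sS i).
by exists n, t; exact: direct_sum_iso tP SY.
Qed.

Lemma mult_simple l j : mult X l (X j) = (l == j).
Proof.
have [sX Xinj _] := hX; rewrite /mult dim_hom_simple //; congr nat_of_bool.
by apply/asboolP/eqP => [/Xinj //|->]; exact: isomorphic_refl.
Qed.

Lemma mult_iso l Y Z : isomorphic Y Z -> mult X l Y = mult X l Z.
Proof. exact: dim_hom_iso_r. Qed.

Lemma mult_direct_sum l n (S : 'I_n -> C) Y : is_direct_sum S Y ->
  mult X l Y = (\sum_i mult X l (S i))%N.
Proof. exact: dim_hom_sum_r. Qed.

Lemma additive_expand (V : nmodType) (F : C -> V) Y :
  (forall n (S : 'I_n -> C) Z, is_direct_sum S Z -> F Z = \sum_i F (S i)) ->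
  F Y = \sum_i F (X i) *+ mult X i Y.
Proof.
move=> Fadd; have [n [t tY]] := decompose Y.
rewrite (Fadd _ _ _ tY) (partition_big t predT) //=; apply: eq_bigr => i _.
rewrite (mult_direct_sum i tY) -sumrMnr big_mkcond /=; apply: eq_bigr => a _.
by rewrite mult_simple eq_sym; case: eqP => [->|].
Qed.

Lemma additive_expand_nat (F : C -> nat) Y :
  (forall n (S : 'I_n -> C) Z, is_direct_sum S Z -> F Z = (\sum_i F (S i))%N) ->
  F Y = (\sum_i mult X i Y * F (X i))%N.
Proof.
move=> Fadd; rewrite (@additive_expand nat F Y Fadd).
by apply: eq_bigr => i _; rewrite -mulr_natr natn mulrC.
Qed.

Lemma mult_tens l Y Z : mult X l (Y ⊗ Z) =
  (\sum_i \sum_j mult X i Y * mult X j Z * mult X l (X i ⊗ X j))%N.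
Proof.
rewrite (@additive_expand_nat (fun A => mult X l (A ⊗ Z))) => [|n S A SA].
  apply: eq_bigr => i _; rewrite (@additive_expand_nat (fun A => mult X l (X i ⊗ A))).
    by rewrite big_distrr /=; apply: eq_bigr => j _; rewrite mulnA.
  by move=> n S A SA; exact: mult_direct_sum (direct_sum_tensr _ SA).
exact: mult_direct_sum (direct_sum_tensl _ SA).
Qed.

Lemma dim_hom_to_simple l Y : \dim {: hom Y (X l)} = mult X l Y.
Proof.
rewrite (@additive_expand_nat (fun A => \dim {: hom A (X l)})) => [|n S A SA].
  rewrite (bigD1 l) //= -[\dim _]/(mult X l (X l)) mult_simple eqxx muln1 big1 ?addn0 //.
  by move=> i il; rewrite -[\dim _]/(mult X i (X l)) mult_simple (negPf il) muln0.
exact: dim_hom_sum_l.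
Qed.

Lemma mult_sum1_iso Y i : mult X i Y = 1%N -> (forall j, j != i -> mult X j Y = 0%N) ->
  isomorphic (X i) Y.
Proof.
move=> mi mj; have [n [t tY]] := decompose Y.
have ti a : t a = i.
  apply/eqP; apply: contraTT isT => /mj; rewrite (mult_direct_sum _ tY) => /eqP.
  by rewrite sum_nat_eq0 => /forallP/(_ a); rewrite mult_simple eqxx.
have n1 : n = 1%N.
  rewrite -mi (mult_direct_sum _ tY).
  by under eq_bigr do rewrite ti mult_simple eqxx; rewrite sum1_card card_ord.
by subst n; rewrite -(ti ord0); exact: direct_sum1 tY.
Qed.

(** The dimension of End(1) is the sum of the squared multiplicities in 1, so dimension 1 leaves one
    simple constituent. *)
Lemma unit_index : exists e, isomorphic (X e) munit.
Proof.
have := fus_unit C; rewrite (@additive_expand_nat (fun A => \dim {: hom A munit})); last first.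
  by move=> n S A SA; exact: dim_hom_sum_l.
rewrite -[X in X = _]/(\sum_i mult X i munit * mult X i munit)%N => s1.
have le1 e j : j != e ->
    (mult X e munit * mult X e munit + mult X j munit * mult X j munit <= 1)%N.
  by move=> je; rewrite -[X in (_ <= X)%N]s1 (bigD1 e) //= (bigD1 j) //= addnA leq_addr.
have [e me] : exists e, mult X e munit != 0%N.
  apply: contrapT => /forallNP ne; move: s1; rewrite big1 // => i _.
  by have /negP/negPn/eqP -> := ne i.
exists e; apply: mult_sum1_iso => [|j /le1].
  have : (mult X e munit * mult X e munit <= 1)%N by rewrite -s1 (bigD1 e) //= leq_addr.
  by case: (mult X e munit) me => [|[|]].
by case: (mult X e munit) (mult X j munit) me => [//|a] [//|b] _; rewrite !mulSn !addSn !addnS.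
Qed.

Lemma fusion_rules_of_cat :
  exists e st, [/\ fusion_rules (fun i j l => mult X l (X i ⊗ X j)) e st,
    isomorphic (X e) munit & forall i, isomorphic (X (st i)) (X i)^∨].
Proof.
have [e Xe] := unit_index.
pose N i j l := mult X l (X i ⊗ X j).
pose M i j := mult X j (X i)^∨.
have Nel j l : N e j l = (j == l).
  have -> : N e j l = mult X l (X j).
    apply: mult_iso; apply: isomorphic_trans (isomorphic_tens Xe (isomorphic_refl _)) _.
    by exists (lunit _), (luniti _); rewrite lunitK lunitiK.
  by rewrite mult_simple eq_sym.
have Nle j l : N j e l = (j == l).
  have -> : N j e l = mult X l (X j).
    apply: mult_iso; apply: isomorphic_trans (isomorphic_tens (isomorphic_refl _) Xe) _.
    by exists (runit _), (runiti _); rewrite runitK runitiK.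
  by rewrite mult_simple eq_sym.
have multX A j l : mult X l (A ⊗ X j) = (\sum_a mult X a A * N a j l)%N.
  rewrite mult_tens; apply: eq_bigr => i _.
  rewrite (bigD1 j) //= mult_simple eqxx muln1 big1 ?addn0 // => b /negPf bj.
  by rewrite mult_simple bj muln0.
have Xmult A j l : mult X l (X j ⊗ A) = (\sum_a mult X a A * N j a l)%N.
  rewrite mult_tens (bigD1 j) //= [X in (_ + X)%N]big1 ?addn0 => [|b /negPf bj].
    by apply: eq_bigr => i _; rewrite mult_simple eqxx mul1n.
  by rewrite big1 // => i _; rewrite mult_simple bj.
have frob i j l : N i j l = (\sum_a M i a * N a l j)%N.
  rewrite -multX -dim_hom_to_simple; apply: esym.
  exact: (dim_hom_dual (X l) (X j) (dpair_of (ldualP (X i)))).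
have Me i j : M i j = N i j e.
  rewrite frob (bigD1 j) //= Nle eqxx muln1 big1 ?addn0 // => a /negPf aj.
  by rewrite Nle aj muln0.
(* Reciprocity [frob] at j = e reads \sum_a M i a * M a l = (i == l). *)
have [|st stP] := @nat_involution_perm _ M.
  by move=> i l; rewrite -Nle frob; apply: eq_bigr => a _; rewrite -Me.
exists e, st; split=> // [|i].
  split=> // [i j k l|i j l].
    rewrite -/(N _ _ _); transitivity (mult X l (X i ⊗ X j ⊗ X k)); first by rewrite multX.
    rewrite (@mult_iso _ _ (X i ⊗ (X j ⊗ X k))) ?Xmult //.
    by exists (assoc _ _ _), (associ _ _ _); rewrite assocK associK.
  rewrite -/(N i j l) frob (bigD1 (st i)) //= stP eqxx mul1n big1 ?addn0 // => a /negPf ai.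
  by rewrite stP ai.
apply: mult_sum1_iso => [|j /negPf ji]; rewrite -[mult _ _ _]/(M i _) stP ?eqxx //.
by rewrite ji.
Qed.

End FusionRing.

(** * Characters of a fusion ring *)

Section Characters.
Variables (K : numClosedFieldType) (m : nat) (N : 'I_m -> 'I_m -> 'I_m -> nat).
Variables (e : 'I_m) (st : 'I_m -> 'I_m).
Hypothesis hN : fusion_rules N e st.
Implicit Types (c d : 'I_m -> K) (i j l : 'I_m).

Definition fusion_char c :=
  c e = 1 /\ forall i j, c i * c j = \sum_l (N i j l)%:R * c l.

Lemma N_unit i j : N i j e = (j == st i).
Proof. by rewrite (Nfrob hN) (N1r hN) eq_sym. Qed.

Lemma st_invol i : st (st i) = i.
Proof.
have := Nfrob hN i e i; rewrite (N1r hN) eqxx N_unit.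
by case: eqP.
Qed.

Lemma sum_normsq_gt0 c : fusion_char c -> 0 < \sum_j c j * (c j)^*.
Proof.
move=> [c1 _]; rewrite (bigD1 e) //= c1 conjC1 mulr1 ltr_pwDl ?ltr01 //.
by apply: sumr_ge0 => j _; rewrite mul_conjC_ge0.
Qed.

(* Multiplication by x_i^* is adjoint to multiplication by x_i, so that two
   characters are eigenvectors of x_i with the eigenvalues c i and
   (c' (st i))^*. *)
Lemma char_adjoint c c' i : fusion_char c -> fusion_char c' ->
  c i * \sum_j c j * (c' j)^* = (c' (st i))^* * \sum_j c j * (c' j)^*.
Proof.
move=> [_ hc] [_ hc']; rewrite !mulr_sumr.
under eq_bigr do rewrite mulrA hc mulr_suml.
rewrite exchange_big /=; apply: eq_bigr => l _.
rewrite mulrCA -rmorphM hc' rmorph_sum mulr_sumr; apply: eq_bigr => j _.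
by rewrite rmorphM rmorph_nat -(Nfrob hN) mulrCA mulrA.
Qed.

Lemma char_st c i : fusion_char c -> c (st i) = (c i)^*.
Proof.
move=> hc; have := char_adjoint i hc hc.
move=> /(mulIf (lt0r_neq0 (sum_normsq_gt0 hc))) ->.
by rewrite conjCK.
Qed.

Lemma char_orth c c' : fusion_char c -> fusion_char c' ->
  (exists i, c i != c' i) -> \sum_j c j * (c' j)^* = 0.
Proof.
move=> hc hc' [i cc']; apply/eqP; apply: contraNT cc' => s0.
by have := char_adjoint i hc hc'; rewrite char_st // conjCK => /(mulIf s0) ->.
Qed.

(** The product x_i x_i^* contains 1, where [c] takes the value 1. *)
Lemma char_nonneg_gt0 c : fusion_char c -> (forall i, 0 <= c i) -> forall i, 0 < c i.
Proof.
move=> [c1 cM] c_ge0 i; rewrite lt0r c_ge0 andbT; apply/eqP => ci0.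
have /eqP := cM i (st i); rewrite ci0 mul0r eq_sym.
rewrite psumr_eq0 => [|j _]; last by rewrite mulr_ge0 ?ler0n.
move=> /allP/(_ e (mem_index_enum _)); rewrite N_unit eqxx c1.
by rewrite mulr1 oner_eq0.
Qed.

Lemma char_normsq c i : fusion_char c -> c i * c (st i) = `|c i| ^+ 2.
Proof. by move=> hc; rewrite char_st // normCK. Qed.

Section Dimension.
Variable d : 'I_m -> K.
Hypotheses (hd : fusion_char d) (d_gt0 : forall i, 0 < d i).

Lemma dim_st i : d (st i) = d i.
Proof. by rewrite char_st //; apply/CrealP; exact: gtr0_real. Qed.

Lemma dim_prod_row i l : \sum_j (N i j l)%:R * d j = d i * d l.
Proof.
rewrite -dim_st (hd.2 (st i) l); apply: eq_bigr => j _.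
by rewrite -(Nfrob hN).
Qed.

(** Pair |c i| |c j| <= \sum_l N i j l |c l| with the positive vector [d]; by [dim_prod_row], [d] is
    an eigenvector of the fusion matrix on that side too, with eigenvalue d i. *)
Lemma char_bound c i : fusion_char c -> `|c i| <= d i.
Proof.
move=> hc; have s0 : 0 < \sum_j `|c j| * d j.
  rewrite (bigD1 e) //= hc.1 hd.1 normr1 mulr1 ltr_pwDl ?ltr01 //.
  by apply: sumr_ge0 => j _; rewrite mulr_ge0 ?normr_ge0 ?ltW.
rewrite -(ler_pM2r s0) !mulr_sumr.
under eq_bigr do rewrite mulrA -normrM hc.2.
apply: (@le_trans _ _ (\sum_j (\sum_l (N i j l)%:R * `|c l|) * d j)).
  apply: ler_sum => j _; rewrite ler_pM2r //.
  by apply: le_trans (ler_norm_sum _ _ _) _; apply: ler_sum => l _; rewrite normrM normr_nat.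
under eq_bigr do rewrite mulr_suml.
rewrite exchange_big le_eqVlt /=; apply/orP; left; apply/eqP/eq_bigr => l _.
rewrite mulrCA -dim_prod_row mulr_sumr; apply: eq_bigr => j _.
by rewrite mulrAC mulrC.
Qed.

(** Equality case of the triangle inequality: each term is bounded in modulus by the corresponding
    term for [d], and the two sums agree. *)
Lemma char_eq_dim_prod c i j l : fusion_char c ->
  c i * c j = d i * d j -> N i j l != 0%N -> c l = d l.
Proof.
move=> hc; rewrite hc.2 hd.2 => /normC_sum_upper eqc Nl.
have : (N i j l)%:R * c l = (N i j l)%:R * d l.
  by apply: eqc => // a _; rewrite normrM normr_nat ler_wpM2l ?ler0n ?char_bound.
by apply: mulfI; rewrite pnatr_eq0.
Qed.

Lemma char_eq_dim_adjoint c i l : fusion_char c ->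
  `|c i| = d i -> N i (st i) l != 0%N -> c l = d l.
Proof.
move=> hc ci; apply: (char_eq_dim_prod hc).
by rewrite char_normsq // ci dim_st expr2.
Qed.

Lemma char_eq_dim_st c i : fusion_char c -> c i = d i -> c (st i) = d (st i).
Proof. by move=> hc ci; rewrite dim_st char_st // ci -char_st ?dim_st. Qed.

Section Integrality.
Variable chi : 'I_m -> 'I_m -> K.
Hypothesis hchi : forall l, fusion_char (chi l).
Hypothesis chi_indep : \matrix_(l, i) chi l i \in unitmx.

Lemma chi_faithful (v : 'I_m -> K) :
  (forall l, \sum_i chi l i * v i = 0) -> forall i, v i = 0.
Proof.
move=> v0 i; pose V := \matrix_(l, i) chi l i.
have Vv : V *m \col_i v i = 0.
  by apply/colP => l; rewrite !mxE -[RHS](v0 l); apply: eq_bigr => j _; rewrite !mxE.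
by have := mulKmx chi_indep (\col_i v i); rewrite Vv mulmx0 => /colP/(_ i); rewrite !mxE.
Qed.

Variable ad : pred 'I_m.
Hypothesis ad_e : ad e.
Hypothesis ad_st : forall i, ad i -> ad (st i).
Hypothesis ad_prod : forall i j l, ad i -> ad j -> N i j l != 0%N -> ad l.
Hypothesis ad_adjoint : forall i l, N i (st i) l != 0%N -> ad l.

Lemma ex_adjoint_product (s : seq 'I_m) : exists y : 'I_m -> nat,
  (forall c, fusion_char c ->
     \sum_l (y l)%:R * c l = \prod_(i <- s) (c i * c (st i))) /\
  (forall l, y l != 0%N -> ad l).
Proof.
elim: s => [|i s [y [yc yad]]].
  exists (fun l => l == e); split=> [c hc|l]; last by case: (l =P e) => [->|].
  rewrite big_nil (bigD1 e) //= eqxx mul1r hc.1 big1 ?addr0 // => l /negPf ->.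
  by rewrite mul0r.
exists (fun l => \sum_a \sum_b N i (st i) a * y b * N a b l)%N; split=> [c hc|l].
  rewrite big_cons -yc // hc.2 big_distrlr /=.
  under eq_bigr do rewrite natr_sum mulr_suml.
  rewrite exchange_big /=; apply: eq_bigr => a _.
  under eq_bigr do rewrite natr_sum mulr_suml.
  rewrite exchange_big /=; apply: eq_bigr => b _.
  rewrite mulrACA hc.2 mulr_sumr; apply: eq_bigr => l _.
  by rewrite !natrM mulrA.
rewrite sum_nat_eq0 => /forallPn[a]; rewrite sum_nat_eq0 => /forallPn[b].
rewrite !implyTb !muln_eq0 !negb_or -andbA => /and3P[Na /yad adb Nab].
exact: ad_prod (ad_adjoint Na) adb Nab.
Qed.

Hypothesis ad_dim : forall l, (forall i, `|chi l i| = d i) ->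
  forall i, ad i -> chi l i = d i.
Hypothesis burnside : forall l,
  (exists i, chi l i = 0) \/ (forall i, `|chi l i| = d i).

(* y below is the class of the product of all X_i ⊗ X_i^*.  It vanishes under
   every character that has a zero, hence is an eigenvector for the adjoint
   subring, i.e. a multiple of its regular element. *)
Lemma burnside_coef : exists y : 'I_m -> nat,
  (forall c, fusion_char c -> \sum_l (y l)%:R * c l = \prod_i (c i * c (st i))) /\
  \prod_i d i ^+ 2 = (y e)%:R * \sum_(i | ad i) d i ^+ 2.
Proof.
have [y [yc yad]] := ex_adjoint_product (index_enum 'I_m); exists y; split=> //.
pose z i l := (\sum_j y j * N j i l)%N.
have zc i c : fusion_char c -> \sum_l (z i l)%:R * c l = (\sum_l (y l)%:R * c l) * c i.
  move=> hc; rewrite mulr_suml.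
  under eq_bigr do rewrite natr_sum mulr_suml.
  rewrite exchange_big /=; apply: eq_bigr => j _.
  rewrite -mulrA hc.2 mulr_sumr; apply: eq_bigr => l _.
  by rewrite natrM mulrA.
have zy i : ad i -> forall l, (z i l)%:R = d i * (y l)%:R.
  move=> adi l; apply/subr0_eq; move: l; apply: chi_faithful => l.
  under eq_bigr do rewrite mulrBr mulrC [chi _ _ * (_ * _)]mulrCA (mulrC (chi _ _)).
  rewrite big_split sumrN -mulr_sumr /= zc // mulrC -mulrBl.
  have [[j cj]|/ad_dim -> //] := burnside l; last by rewrite subrr mul0r.
  by rewrite yc // (bigD1 j) //= cj !mul0r mulr0.
(* Compare the coefficients of 1 in y x_i^* = d_i y. *)
have ye i : ad i -> (y i)%:R = d i * (y e)%:R.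
  move=> adi; rewrite -dim_st -zy ?ad_st // /z (bigD1 i) //= N_unit eqxx muln1.
  rewrite big1 ?addn0 // => j ji; rewrite N_unit (inj_eq (can_inj st_invol)).
  by rewrite eq_sym (negPf ji) muln0.
have <- : \sum_l (y l)%:R * d l = \prod_i d i ^+ 2.
  by rewrite yc //; apply: eq_bigr => i _; rewrite dim_st expr2.
rewrite (bigID ad) /= [X in _ + X]big1 ?addr0 => [|i /negPf adi].
  by rewrite mulr_sumr; apply: eq_bigr => i /ye ->; rewrite expr2 mulrAC mulrC.
by have := yad i; rewrite adi; case: eqP => [-> _|_ /(_ isT)//]; rewrite mul0r.
Qed.

End Integrality.
End Dimension.
End Characters.

(** The order of K is only partial, but norms are real and thus comparable. *)
Lemma ex_max_norm (K : numDomainType) (I : finType) (i0 : I) (f : I -> K) :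
  exists i, forall j, `|f j| <= `|f i|.
Proof.
suff [i _ iP] : exists2 i, i \in i0 :: enum I & forall j, j \in i0 :: enum I ->
    `|f j| <= `|f i|.
  by exists i => j; apply: iP; rewrite in_cons mem_enum orbT.
elim: (enum I) => [|i s [a a_s aP]].
  by exists i0; rewrite ?mem_head // => j; rewrite inE => /eqP ->.
have [ia|ai] := real_leP (normr_real (f i)) (normr_real (f a)).
  exists a => [|j]; first by move: a_s; rewrite !inE => /orP[->//|->]; rewrite !orbT.
  by rewrite !inE orbCA => /orP[/eqP -> //|js]; apply: aP; rewrite inE.
exists i => [|j]; first by rewrite !inE eqxx orbT.
rewrite !inE orbCA => /orP[/eqP -> //|js].
by apply: le_trans (ltW ai); apply: aP; rewrite inE.
Qed.

(** * Orthogonality and Perron-Frobenius theory for a character table *)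

Section Diagonalization.
Variables (K : numClosedFieldType) (m : nat) (N : 'I_m -> 'I_m -> 'I_m -> nat).
Variables (e : 'I_m) (st : 'I_m -> 'I_m).
Hypothesis hN : fusion_rules N e st.
Variable chi : 'I_m -> 'I_m -> K.
Hypothesis hchi : forall l, fusion_char N e (chi l).
Hypothesis chi_indep : \matrix_(l, i) chi l i \in unitmx.

(** The formal codegree of the l-th character, n_l in the overview. *)
Definition codegree l := \sum_j `|chi l j| ^+ 2.

Lemma codegreeE l : codegree l = \sum_j chi l j * (chi l j)^*.
Proof. by apply: eq_bigr => j _; rewrite normCK. Qed.

Lemma codegree_gt0 l : 0 < codegree l.
Proof. by rewrite codegreeE; exact: sum_normsq_gt0 (hchi l). Qed.

Lemma chi_inj l l' : l != l' -> exists i, chi l i != chi l' i.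
Proof.
move=> ll'; apply: contrapT => /forallNP eqll'.
pose V := \matrix_(l, i) chi l i; pose u : 'rV[K]_m := delta_mx 0 l - delta_mx 0 l'.
have uV : u *m V = 0.
  apply/rowP => i; rewrite mulmxBl -!rowE !mxE.
  by have /negP/negPn/eqP -> := eqll' i; rewrite subrr.
have := mulmxK chi_indep u; rewrite uV mul0mx => /rowP/(_ l).
by rewrite !mxE !eqxx (negPf ll') subr0 => /eqP; rewrite eq_sym oner_eq0.
Qed.

Lemma chi_orth l l' : \sum_j chi l j * (chi l' j)^* = codegree l *+ (l == l').
Proof.
have [<-|ll'] := eqVneq l l'; first by rewrite codegreeE.
by rewrite (char_orth hN (hchi l) (hchi l') (chi_inj ll')).
Qed.

Section PerronFrobenius.

(** Multiplication by the sum of all x_i. This element is self-dual, so its eigenvalues [r l] are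
    real. *)
Let A j k : K := \sum_i (N i j k)%:R.
Let r l := \sum_i chi l i.

Lemma total_mul_eigen l j : \sum_k A j k * chi l k = r l * chi l j.
Proof.
rewrite /A /r mulr_suml; under eq_bigr do rewrite mulr_suml.
by rewrite exchange_big /=; apply: eq_bigr => i _; rewrite (hchi l).2.
Qed.

Lemma total_mul_unit k : A e k = 1.
Proof.
rewrite /A (bigD1 k) //= (N1r hN) eqxx big1 ?addr0 // => i /negPf ik.
by rewrite (N1r hN) ik.
Qed.

Lemma total_char_real l : r l \is Num.real.
Proof.
apply/CrealP; rewrite /r rmorph_sum (reindex_inj (can_inj (st_invol hN))) /=.
by apply: eq_bigr => i _; rewrite -(char_st hN) // (st_invol hN).
Qed.

(* The entrywise modulus u of an eigenvector of maximal eigenvalue x satisfies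
   A u >= x u entrywise, while A <= x as a quadratic form. *)
Lemma modulus_eigen x l : `|r l| = x -> (forall l', `|r l'| <= x) ->
  (forall j, \sum_k A j k * `|chi l k| = x * `|chi l j|) /\
  exists l', r l' = x.
Proof.
move=> rl rmax; pose u j := `|chi l j|.
pose V := \matrix_(l, i) chi l i; pose a := \row_j u j *m invmx V.
have uE j : u j = \sum_l' a 0 l' * chi l' j.
  have := mulmxKV chi_indep (\row_j u j) => /rowP/(_ j).
  by rewrite [X in _ = X -> _]mxE => <-; rewrite mxE; apply: eq_bigr => l1 _; congr (_ * _); rewrite mxE.
have AuE j : \sum_k A j k * u k = \sum_l' a 0 l' * r l' * chi l' j.
  under eq_bigr do rewrite uE mulr_sumr.
  rewrite exchange_big /=; apply: eq_bigr => l' _.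
  by rewrite -mulrA -total_mul_eigen mulr_sumr; apply: eq_bigr => k _; rewrite mulrCA.
have le_Au j : x * u j <= \sum_k A j k * u k.
  rewrite -rl -normrM -total_mul_eigen; apply: le_trans (ler_norm_sum _ _ _) _.
  apply: ler_sum => k _; rewrite normrM ger0_norm // /A.
  by apply: sumr_ge0 => i _; rewrite ler0n.
(* With [a] the coordinates of u in the basis of characters, orthogonality diagonalizes the
   quadratic form of A - x. The left side is nonnegative, the right side nonpositive. *)
have QE : \sum_j (\sum_k A j k * u k - x * u j) * u j =
    \sum_l' - (`|a 0 l'| ^+ 2 * codegree l' * (x - r l')).
  transitivity (\sum_l' \sum_l'' a 0 l' * (r l' - x) * (a 0 l'')^* *
      \sum_j chi l' j * (chi l'' j)^*).
    under [RHS]eq_bigr => l' _ do under eq_bigr => l'' _ do rewrite mulr_sumr.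
    under [RHS]eq_bigr => l' _ do rewrite exchange_big /=.
    rewrite [RHS]exchange_big /=; apply: eq_bigr => j _.
    have -> : \sum_k A j k * u k - x * u j = \sum_l' a 0 l' * (r l' - x) * chi l' j.
      by rewrite AuE uE mulr_sumr -sumrB; apply: eq_bigr => l' _; ring.
    have -> : u j = \sum_l' (a 0 l')^* * (chi l' j)^*.
      rewrite -[LHS](CrealP (normr_real _)) -/(u j) uE rmorph_sum.
      by apply: eq_bigr => l' _; rewrite rmorphM.
    rewrite big_distrlr /=; apply: eq_bigr => l' _; apply: eq_bigr => l'' _.
    ring.
  apply: eq_bigr => l' _; rewrite (bigD1 l') //= [X in _ + X]big1 => [|l'' /negPf l'l''].
    by rewrite addr0 chi_orth eqxx mulr1n normCK; ring.
  by rewrite chi_orth eq_sym l'l'' mulr0n mulr0.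
have x_ge l' : 0 <= x - r l'.
  by rewrite subr_ge0; apply: le_trans (rmax l'); apply: real_ler_norm; exact: total_char_real.
have term_ge0 l' : 0 <= `|a 0 l'| ^+ 2 * codegree l' * (x - r l').
  by rewrite !mulr_ge0 ?exprn_ge0 ?normr_ge0 // ltW ?codegree_gt0.
have Q_ge0 : 0 <= \sum_j (\sum_k A j k * u k - x * u j) * u j.
  by apply: sumr_ge0 => j _; rewrite mulr_ge0 ?subr_ge0 ?le_Au ?normr_ge0.
(* So only characters with eigenvalue x occur in u, and one does occur since u e = 1. *)
have a0 l' : a 0 l' * r l' = a 0 l' * x.
  have sum0 : \sum_l' `|a 0 l'| ^+ 2 * codegree l' * (x - r l') = 0.
    by apply/eqP; rewrite eq_le sumr_ge0 // andbT -oppr_ge0 -sumrN -QE.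
  have /(_ l' isT)/eqP := psumr_eq0P (fun l _ => term_ge0 l) sum0.
  rewrite !mulf_eq0 (negPf (lt0r_neq0 (codegree_gt0 l'))) orbF orbb normr_eq0.
  by move=> /orP[/eqP -> |]; rewrite ?mul0r // subr_eq0 => /eqP ->.
split=> [j|].
  by rewrite AuE -/(u j) uE mulr_sumr; apply: eq_bigr => l' _; rewrite a0 mulrCA mulrA.
apply: contrapT => /forallNP nr.
have /eqP : u e = 0.
  rewrite uE big1 // => l' _.
  have /eqP := a0 l'; rewrite -subr_eq0 -mulrBr mulf_eq0 subr_eq0.
  by move=> /orP[/eqP ->|/eqP /nr//]; rewrite mul0r.
by rewrite /u (hchi l).1 normr1 oner_eq0.
Qed.

(** Row e of A consists of ones, so there the eigenvector equation says that the sum of the |chi k|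
    equals the modulus of the sum of the chi k: all entries have the same phase, which is that of
    the entry 1 at e. *)
Lemma exists_positive_char : exists l, forall i, 0 < chi l i.
Proof.
have [l lmax] := ex_max_norm e r.
have [_ [l1 rl1]] := modulus_eigen erefl lmax.
have rl1_norm : `|r l1| = `|r l| by rewrite rl1 normr_id.
have [eig _] := modulus_eigen rl1_norm lmax.
have := eig e; rewrite (hchi l1).1 normr1 mulr1 -rl1_norm => /esym.
under eq_bigr do rewrite total_mul_unit mul1r.
move=> /normC_sum_eq[t _ tP].
have t1 : t = 1 by have := tP e isT; rewrite (hchi l1).1 normr1 mul1r.
have chi_ge0 i : 0 <= chi l1 i by rewrite (tP i isT) t1 mulr1 normr_ge0.
by exists l1; exact: (char_nonneg_gt0 hN (hchi l1) chi_ge0).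
Qed.

End PerronFrobenius.

Section Symmetric.
Hypothesis chi_sym : forall i j, chi i j * chi e i = chi j i * chi e j.
Hypothesis chi_e_neq0 : forall i, chi e i != 0.

(** For a modular category U is the S-matrix divided by dim X_e. Being symmetric, it satisfies the
    row relations in conjugated form as column relations. *)
Lemma symmetric_matrices (U := \matrix_(i, j) (chi i j * chi e i))
    (D := \row_i (codegree i * `|chi e i| ^+ 2)) :
  U *m map_mx Num.conj U = diag_mx D /\ map_mx Num.conj U *m U = diag_mx D.
Proof.
have UU : U *m map_mx Num.conj U = diag_mx D.
  apply/matrixP => i j; rewrite !mxE.
  transitivity (\sum_k (chi e i * (chi e j)^*) * (chi i k * (chi j k)^*)).
    apply: eq_bigr => k _; rewrite !mxE chi_sym [chi k j * _]chi_sym -chi_sym rmorphM /=.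
    ring.
  rewrite -mulr_sumr chi_orth; have [<-|_] := eqVneq i j; last by rewrite mulr0.
  by rewrite !mulr1n normCK mulrC.
split=> //; have := congr1 (map_mx Num.conj) UU; rewrite map_mxM.
have -> : map_mx Num.conj (map_mx Num.conj U) = U.
  by apply/matrixP => i j; rewrite !mxE conjCK.
move=> ->; apply/matrixP => i j; rewrite !mxE rmorphMn /=; congr (_ *+ _).
by apply/CrealP; rewrite ger0_real // mulr_ge0 ?exprn_ge0 ?normr_ge0 // ltW ?codegree_gt0.
Qed.

(** D U = U conj(U) U = U D; since row e of U has no zero entry, the diagonal D is constant. *)
Lemma codegree_const l : codegree l * `|chi e l| ^+ 2 = codegree e.
Proof.
have [UU' U'U] := symmetric_matrices.
set U := (\matrix_(i, j) _) in UU' U'U; set D := (\row_i _) in UU' U'U.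
have : diag_mx D *m U = U *m diag_mx D by rewrite -{1}UU' -mulmxA U'U.
move=> /matrixP/(_ e l); rewrite mul_diag_mx mul_mx_diag !mxE (hchi e).1 mulr1.
by rewrite normr1 expr1n mulr1 mulrC => /(mulfI (chi_e_neq0 l)) ->.
Qed.

Lemma chi_orth_col i :
  \sum_l `|chi e l| ^+ 2 * chi l i = codegree e *+ (i == e).
Proof.
have [_ U'U] := symmetric_matrices.
have := U'U => /matrixP/(_ e i); rewrite !mxE codegree_const eq_sym => <-.
apply: eq_bigr => l _; rewrite !mxE (hchi e).1 mulr1 normCK.
ring.
Qed.

End Symmetric.
End Diagonalization.

(** * Integrality and rationality *)

Section Integrality.
Variable K : numClosedFieldType.

Local Notation algint := (integralOver (intr : int -> K)).

Lemma map_intr_ratr (p : {poly int}) :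
  map_poly (ratr : rat -> K) (map_poly intr p) = map_poly intr p.
Proof. by rewrite -map_poly_comp; apply: eq_map_poly => z /=; rewrite ratr_int. Qed.

Lemma rat_algint_int (q : rat) : algint (ratr q) -> exists z : int, q = z%:~R.
Proof.
move=> [p pmon]; rewrite -map_intr_ratr fmorph_root => rq.
have /intrP[z qz] : (ratr q : algC) \is a Num.int.
  apply: Cint_rat_Aint; first exact: Crat_rat.
  apply: (@root_monic_Aint (map_poly intr p)).
  - have : root (map_poly ratr (map_poly intr p)) (ratr q : algC) by rewrite fmorph_root.
    by rewrite -map_poly_comp; congr (root _ _); apply: eq_map_poly => z /=; rewrite ratr_int.
  - exact: monic_map.
  - by apply/polyOverP => i; rewrite coef_map /= intr_int.
by exists z; move: qz; rewrite -(ratr_int _ z) => /fmorph_inj.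
Qed.

Lemma rat_algint_nat (q : rat) : 0 <= q -> algint (ratr q) -> exists n : nat, q = n%:R.
Proof.
move=> q0 /rat_algint_int[z qz]; exists `|z|%N; move: q0; rewrite qz ler0z => z0.
by rewrite pmulrn gez0_abs.
Qed.

Lemma algint_sum (I : finType) (f : I -> K) : (forall i, algint (f i)) -> algint (\sum_i f i).
Proof.
by move=> fI; apply: big_ind => [|x y|//]; [exact: integral0|exact: integral_add].
Qed.

Lemma algint_prod (I : finType) (f : I -> K) : (forall i, algint (f i)) -> algint (\prod_i f i).
Proof.
by move=> fI; apply: big_ind => [|x y|//]; [exact: integral1|exact: integral_mul].
Qed.

Lemma algint_exp (x : K) n : algint x -> algint (x ^+ n).
Proof.
by move=> xI; elim: n => [|n IH]; [exact: integral1|rewrite exprS; exact: integral_mul].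
Qed.

(* Kronecker: the conjugates of x are among the roots of p, so the norm of x
   is a nonzero integer of modulus at most 1. *)
Lemma algint_conjugates_le1 (x : K) (p : {poly rat}) :
  algint x -> root (map_poly ratr p) x ->
  (forall y : K, root (map_poly ratr p) y -> 0 < y <= 1) -> x = 1.
Proof.
(* The roots of h are roots of p, so they lie in (0, 1]; as a divisor of the monic q it is, by
   Gauss, proportional to an integral polynomial [q1] with leading coefficient of absolute value
   1. *)
move=> [q qmon rq] rp p01; pose h := gcdp (map_poly intr q) p.
have rh : root (map_poly ratr h) x.
  by rewrite gcdp_map root_gcd map_intr_ratr rq rp.
have hdvd : (h %| map_poly (intr : int -> rat) q)%R by exact: dvdp_gcdl.
have [q1 [a a0 hE] [s qs]] := dvdpP_rat_int hdvd.
have rootq1 (y : K) : root (map_poly intr q1) y -> root (map_poly ratr h) y.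
  by rewrite hE map_polyZ rootZ ?fmorph_eq0 // map_intr_ratr.
have q1x : root (map_poly intr q1) x.
  by move: rh; rewrite hE map_polyZ rootZ ?fmorph_eq0 // map_intr_ratr.
have lead1 : `|lead_coef q1| = 1.
  have /eqP := monicP qmon; rewrite qs lead_coefM => /eqP /(congr1 (@absz)).
  rewrite abszM /= => /eqP; rewrite muln_eq1 => /andP[/eqP l1 _].
  by rewrite -abszE l1.
have [rs rsE] := closed_field_poly_normal (map_poly intr q1 : {poly K}).
have lead0 : lead_coef (map_poly intr q1 : {poly K}) = (lead_coef q1)%:~R.
  by rewrite lead_coef_map_eq // intr_eq0 -normr_eq0 lead1.
have rs01 z : z \in rs -> 0 < z <= 1.
  move=> zrs; apply: p01; have : root (map_poly ratr h) z.
    apply: rootq1; rewrite rsE rootZ; first by rewrite root_prod_XsubC.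
    by rewrite lead0 intr_eq0 -normr_eq0 lead1.
  by rewrite gcdp_map root_gcd => /andP[].
have prod1 : 1 <= \prod_(z <- rs) z.
  have rs_ge0 : 0 <= \prod_(z <- rs) z.
    by rewrite big_seq; apply: prodr_ge0 => z /rs01/andP[/ltW].
  have rs_neq0 : \prod_(z <- rs) z != 0.
    by rewrite prodf_seq_neq0; apply/allP => z /rs01/andP[/lt0r_neq0].
  have normE : `|(map_poly intr q1 : {poly K}).[0]| = \prod_(z <- rs) z.
    rewrite rsE lead0 hornerZ normrM horner_prod normr_prod -intr_norm lead1 mul1r.
    rewrite !big_seq; apply: eq_bigr => z /rs01/andP[z0 _].
    by rewrite !hornerE normrN gtr0_norm.
  move: rs_neq0; rewrite -normE horner_coef0 coef_map /= -intr_norm intr_eq0.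
  by rewrite ler1z -gtz0_ge1 lt0r normr_ge0 => ->.
have : x \in rs.
  move: q1x; rewrite rsE rootZ ?root_prod_XsubC //.
  by rewrite lead0 intr_eq0 -normr_eq0 lead1.
(* A product of factors in (0, 1] that is at least 1 has all factors equal to 1. *)
elim: rs rs01 prod1 {rsE} => [//|z rs IH] rs01; rewrite big_cons => prod1.
have /andP[z0 z1] := rs01 z (mem_head _ _).
have {}rs01 y : y \in rs -> 0 < y <= 1 by move=> yrs; apply: rs01; rewrite inE yrs orbT.
have rs_le1 : 0 <= \prod_(z <- rs) z <= 1.
  rewrite big_seq; apply: (big_ind (fun z => 0 <= z <= 1)) => [|a1 b1|y].
  - by rewrite ler01 lexx.
  - by move=> /andP[a0' a1'] /andP[b0 b1']; rewrite mulr_ge0 // mulr_ile1.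
  - by move=> /rs01/andP[/ltW -> ->].
have [rs_ge0 rs_le1'] := andP rs_le1.
rewrite inE => /orP[/eqP ->|xrs].
  apply/le_anti; rewrite z1 /=; apply: le_trans prod1 _.
  by rewrite -[leRHS]mulr1 ler_pM2l.
apply: IH => //.
by apply: le_trans prod1 _; rewrite -[leRHS]mul1r ler_wpM2r.
Qed.

End Integrality.

Local Notation algint K := (integralOver (intr : int -> K)).

(** * Rational functions on the set of characters *)

Section RationalFunctions.
Variables (K : numClosedFieldType) (m : nat) (chi : 'I_m -> 'I_m -> K).
Hypothesis chi_indep : \matrix_(l, i) chi l i \in unitmx.

Let W : 'M[K]_m := \matrix_(i, l) chi l i.

Lemma char_table_unit : W \in unitmx.
Proof.
rewrite -unitmx_tr (_ : W^T = \matrix_(l, i) chi l i) //.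
by apply/matrixP => i j; rewrite !mxE.
Qed.

Lemma root_char_poly_diag (B : 'M[K]_m) (g : 'I_m -> K) x :
  B *m W = W *m diag_mx (\row_l g l) ->
  root (char_poly B) x <-> exists l, x = g l.
Proof.
move=> BW; rewrite -eigenvalue_root_char; split=> [/eigenvalueP[v vB v0]|[l ->]].
  have vW0 : v *m W != 0.
    by apply: contraNneq v0 => vW; rewrite -(mulmxK char_table_unit v) vW mul0mx.
  have [l vWl] : exists l, (v *m W) 0 l != 0.
    apply: contrapT => /forallNP vW; case/eqP: vW0; apply/rowP => l.
    by rewrite [RHS]mxE; have /negP/negPn/eqP := vW l.
  exists l; apply: (mulIf vWl).
  have diagE (y : 'rV_m) : x *: y = y *m diag_mx (\row_l g l) -> x * y 0 l = g l * y 0 l.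
    by rewrite mul_mx_diag => /rowP/(_ l); rewrite !mxE => ->; rewrite mulrC.
  by apply: diagE; rewrite scalemxAl -vB -!mulmxA BW.
apply/eigenvalueP; exists (row l (invmx W)).
  have : invmx W *m B = diag_mx (\row_l g l) *m invmx W.
    by rewrite -[LHS](mulmxK char_table_unit) -(mulmxA _ B) BW mulmxA mulVmx ?char_table_unit // mul1mx.
  move=> /(congr1 (row l)); rewrite row_mul => ->.
  by rewrite mul_diag_mx; apply/rowP => j; rewrite !mxE.
apply/eqP => /(congr1 (fun v => v *m W)); rewrite -row_mul mulVmx ?char_table_unit // mul0mx.
by move=> /rowP/(_ l) /eqP; rewrite !mxE eqxx oner_eq0.
Qed.

(* The functions of l arising as eigenvalues, on the l-th character, of a
   rational endomorphism of the fusion ring. *)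
Definition ratl (g : 'I_m -> K) := exists A : 'M[rat]_m,
  map_mx ratr A *m W = W *m diag_mx (\row_l g l).

Lemma eq_ratl g h : g =1 h -> ratl g -> ratl h.
Proof.
move=> gh [A AW]; exists A; rewrite AW; congr (_ *m diag_mx _).
by apply/rowP => l; rewrite !mxE.
Qed.

Lemma ratl_const q : ratl (fun=> ratr q).
Proof.
exists q%:M; rewrite map_scalar_mx mul_scalar_mx.
rewrite (_ : \row_l _ = const_mx (ratr q)) ?diag_const_mx ?mul_mx_scalar //.
by apply/rowP => l; rewrite !mxE.
Qed.

Lemma ratlD g h : ratl g -> ratl h -> ratl (fun l => g l + h l).
Proof.
move=> [A AW] [B BW]; exists (A + B); rewrite map_mxD mulmxDl AW BW -mulmxDr -linearD.
by congr (_ *m diag_mx _); apply/rowP => l; rewrite !mxE.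
Qed.

Lemma ratlM g h : ratl g -> ratl h -> ratl (fun l => g l * h l).
Proof.
move=> [A AW] [B BW]; exists (A *m B).
rewrite map_mxM -mulmxA BW mulmxA AW -mulmxA mulmx_diag.
by congr (_ *m diag_mx _); apply/rowP => l; rewrite !mxE.
Qed.

Lemma ratl_sum (I : finType) (g : I -> 'I_m -> K) :
  (forall i, ratl (g i)) -> ratl (fun l => \sum_i g i l).
Proof.
move=> gr; elim: (index_enum I) => [|i s IH].
  by apply: eq_ratl (ratl_const 0) => l; rewrite big_nil rmorph0.
by apply: eq_ratl (ratlD (gr i) IH) => l; rewrite big_cons.
Qed.

Lemma ratl_prod (I : finType) (g : I -> 'I_m -> K) :
  (forall i, ratl (g i)) -> ratl (fun l => \prod_i g i l).
Proof.
move=> gr; elim: (index_enum I) => [|i s IH].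
  by apply: eq_ratl (ratl_const 1) => l; rewrite big_nil rmorph1.
by apply: eq_ratl (ratlM (gr i) IH) => l; rewrite big_cons.
Qed.

Lemma ratl_exp g n : ratl g -> ratl (fun l => g l ^+ n).
Proof.
move=> gr; elim: n => [|n IH].
  by apply: eq_ratl (ratl_const 1) => l; rewrite rmorph1.
by apply: eq_ratl (ratlM gr IH) => l; rewrite exprS.
Qed.

Lemma ratl_horner g (p : {poly rat}) : ratl g -> ratl (fun l => (map_poly ratr p).[g l]).
Proof.
move=> gr; elim/poly_ind: p => [|p q IH].
  by apply: eq_ratl (ratl_const 0) => l; rewrite map_poly0 horner0 rmorph0.
apply: eq_ratl (ratlD (ratlM IH gr) (ratl_const q)) => l.
by rewrite rmorphD rmorphM /= map_polyX map_polyC !hornerE.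
Qed.

Lemma ratl_poly g : ratl g -> exists2 p : {poly rat}, p \is monic &
  forall x, root (map_poly ratr p) x <-> exists l, x = g l.
Proof.
move=> [A AW]; exists (char_poly A); first exact: char_poly_monic.
by move=> x; rewrite map_char_poly; exact: root_char_poly_diag.
Qed.

(** Remove all factors X - q from a rational polynomial whose roots are the values of g: the
    remaining r vanishes at the other values but not at q, so r(g) / r(q) is the indicator. *)
Lemma ratl_indicator g (q : rat) : ratl g -> ratl (fun l => (g l == ratr q)%:R).
Proof.
move=> gr; have [p pmon proot] := ratl_poly gr.
have [k [r rq pE]] := multiplicity_XsubC p q.
rewrite monic_neq0 //= in rq.
apply: eq_ratl (ratlM (ratl_horner r gr) (ratl_const (r.[q])^-1)) => l.
rewrite fmorphV; have [->|gq] := eqVneq (g l) (ratr q).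
  by rewrite horner_map divff // fmorph_eq0.
suff /eqP -> : root (map_poly ratr r) (g l) by rewrite mul0r.
have : root (map_poly ratr p) (g l) by apply/proot; exists l.
rewrite pE rmorphM rootM => /orP[//|]; rewrite rmorphXn rmorphB /= map_polyX map_polyC /=.
rewrite rootE horner_exp !hornerE expf_eq0 subr_eq0 => /andP[_ /eqP gl].
by rewrite gl eqxx in gq.
Qed.

Lemma ratl_sum_rat g : ratl g -> exists q, \sum_l g l = ratr q.
Proof.
move=> [A AW]; exists (\tr A); rewrite -trace_map_mx -[map_mx _ _](mulmxK char_table_unit) AW.
rewrite mxtrace_mulC mulmxA mulVmx ?char_table_unit // mul1mx mxtrace_diag.
by apply: eq_bigr => l _; rewrite mxE.
Qed.

Lemma ratl_prod_rat g : ratl g -> exists q, \prod_l g l = ratr q.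
Proof.
move=> [A AW]; exists (\det A); rewrite -det_map_mx.
have /(congr1 determinant) := AW; rewrite !det_mulmx det_diag mulrC => /mulrI -> //.
  by apply: eq_bigr => l _; rewrite mxE.
by have := char_table_unit; rewrite unitmxE.
Qed.

End RationalFunctions.

Section FusionRational.
Variables (K : numClosedFieldType) (m : nat) (N : 'I_m -> 'I_m -> 'I_m -> nat).
Variables (e : 'I_m) (chi : 'I_m -> 'I_m -> K).
Hypothesis hchi : forall l, fusion_char N e (chi l).
Hypothesis chi_indep : \matrix_(l, i) chi l i \in unitmx.

Lemma mulmx_fusion (F : nzRingType) (f : {rmorphism F -> K}) i :
  map_mx f (\matrix_(j, k) (N i j k)%:R) *m (\matrix_(i, l) chi l i) =
  (\matrix_(i, l) chi l i) *m diag_mx (\row_l chi l i).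
Proof.
apply/matrixP => j l; rewrite mul_mx_diag !mxE mulrC (hchi l).2.
by apply: eq_bigr => k _; rewrite !mxE rmorph_nat.
Qed.

Lemma ratl_chi i : ratl chi (fun l => chi l i).
Proof. by exists (\matrix_(j, k) (N i j k)%:R); exact: mulmx_fusion. Qed.

Lemma algint_chi l i : algint K (chi l i).
Proof.
pose A : 'M[int]_m := \matrix_(j, k) (N i j k)%:R.
exists (char_poly A); first exact: char_poly_monic.
rewrite map_char_poly.
apply: (root_char_poly_diag chi_indep (chi l i) (mulmx_fusion _ i)).2.
by exists l.
Qed.

End FusionRational.

(** * Weakly integral character tables *)

Section WeaklyIntegral.
Variables (K : numClosedFieldType) (m : nat) (N : 'I_m -> 'I_m -> 'I_m -> nat).
Variables (e : 'I_m) (st : 'I_m -> 'I_m).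
Hypothesis hN : fusion_rules N e st.
Variable chi : 'I_m -> 'I_m -> K.
Hypothesis hchi : forall l, fusion_char N e (chi l).
Hypothesis chi_indep : \matrix_(l, i) chi l i \in unitmx.
Hypothesis chi_sym : forall i j, chi i j * chi e i = chi j i * chi e j.
Hypothesis chi_e_neq0 : forall i, chi e i != 0.
Variable l0 : 'I_m.
Hypothesis chi_gt0 : forall i, 0 < chi l0 i.
Variable D : nat.
Hypothesis D_def : \sum_i chi l0 i ^+ 2 = D%:R.

Let d := chi l0.
Let n := codegree chi.

Lemma codegree_dim : n l0 = D%:R.
Proof. by rewrite -D_def; apply: eq_bigr => i _; rewrite gtr0_norm. Qed.

Lemma global_dim_gt0 : (0 < D%:R :> K).
Proof. by rewrite -codegree_dim; exact: codegree_gt0 hchi l0. Qed.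

Lemma global_dim_neq0 : D%:R != 0 :> K. Proof. exact: lt0r_neq0 global_dim_gt0. Qed.

Lemma chi_norm_le l i : `|chi l i| <= d i.
Proof. exact: (char_bound hN (hchi l0) chi_gt0). Qed.

Lemma normsq_le l i : `|chi l i| ^+ 2 <= d i ^+ 2.
Proof. by rewrite ler_pXn2r ?nnegrE ?normr_ge0 ?chi_norm_le // ltW ?chi_gt0. Qed.

Lemma codegree_le l : n l <= D%:R.
Proof. by rewrite -D_def; apply: ler_sum => i _; exact: normsq_le. Qed.

Lemma codegree_max_norm l : n l = D%:R -> forall i, `|chi l i| = d i.
Proof.
move=> nl i; apply/eqP; rewrite -(@eqrXn2 _ 2) ?normr_ge0 //; last exact/ltW/chi_gt0.
rewrite eq_le normsq_le -subr_le0 /=.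
have sum0 : \sum_i (d i ^+ 2 - `|chi l i| ^+ 2) = 0.
  by rewrite sumrB D_def -nl subrr.
have /psumr_eq0P/(_ sum0) -> // : forall i, true -> 0 <= d i ^+ 2 - `|chi l i| ^+ 2.
by move=> j _; rewrite subr_ge0 normsq_le.
Qed.

Lemma ratl_normsq i : ratl chi (fun l => `|chi l i| ^+ 2).
Proof.
apply: eq_ratl (ratlM (ratl_chi hchi i) (ratl_chi hchi (st i))) => l.
by rewrite (char_normsq hN i (hchi l)).
Qed.

Lemma ratl_codegree : ratl chi n.
Proof. by apply: ratl_sum => i; exact: ratl_normsq. Qed.

Lemma algint_normsq l i : algint K (`|chi l i| ^+ 2).
Proof.
rewrite -(char_normsq hN i (hchi l)).
by apply: integral_mul; refine (algint_chi hchi chi_indep _ _).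
Qed.

(** By [codegree_const] at l0, n_e / D = |chi_e(x_l0)|^2 is an algebraic integer. It is a root of a
    rational polynomial whose roots are the n_l / D, all in (0, 1], so it is 1. *)
Lemma codegree_e : n e = D%:R.
Proof.
have ne := codegree_const hN hchi chi_indep chi_sym chi_e_neq0 l0.
rewrite -/n codegree_dim in ne.
have a1 : `|chi e l0| ^+ 2 = 1.
  have [p _ proot] := ratl_poly chi_indep (ratlM ratl_codegree (ratl_const chi (D%:R)^-1)).
  apply: (algint_conjugates_le1 (algint_normsq e l0)).
    by apply/proot; exists e; rewrite fmorphV rmorph_nat -ne mulrAC mulfV ?mul1r ?global_dim_neq0.
  move=> _ /proot[l ->]; rewrite fmorphV rmorph_nat divr_gt0 ?global_dim_gt0 //=; last first.
    exact: codegree_gt0 hchi l.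
  by rewrite ler_pdivrMr ?global_dim_gt0 // mul1r codegree_le.
by rewrite -ne a1 mulr1.
Qed.

Lemma chi_e_norm i : `|chi e i| = d i. Proof. exact: codegree_max_norm codegree_e i. Qed.

Lemma codegree_mul_dimsq l : n l * d l ^+ 2 = D%:R.
Proof.
have := codegree_const hN hchi chi_indep chi_sym chi_e_neq0 l.
by rewrite -/n chi_e_norm codegree_e.
Qed.

(** On the characters with n_l = D the value |chi_l(x_i)|^2 is d_i^2. Summing over this rational
    level set gives a positive multiple of d_i^2 that is rational, and d_i^2 is an algebraic
    integer. *)
Lemma dimsq_nat i : exists2 w : nat, d i ^+ 2 = w%:R & (0 < w)%N.
Proof.
have [q qE] := ratl_sum_rat chi_indep
  (ratlM (ratl_indicator chi_indep D%:R ratl_codegree) (ratl_normsq i)).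
pose c := #|[pred l | n l == D%:R]|.
have c0 : c%:R != 0 :> K.
  by rewrite pnatr_eq0 -lt0n; apply/card_gt0P; exists l0; rewrite inE codegree_dim.
have cE : d i ^+ 2 * c%:R = ratr q.
  rewrite -qE mulr_natr -sumr_const big_mkcond /=; apply: eq_bigr => l _.
  rewrite inE rmorph_nat; case: eqP => [/codegree_max_norm ->|_]; last by rewrite mul0r.
  by rewrite mul1r.
have dE : d i ^+ 2 = ratr (q / c%:R).
  by rewrite fmorph_div /= -cE rmorph_nat mulfK.
have d2 : 0 < d i ^+ 2 by rewrite exprn_gt0 ?chi_gt0.
have [||w wE] := @rat_algint_nat K (q / c%:R).
- by rewrite -(ler0q K) -dE ltW.
- by have := algint_normsq l0 i; rewrite gtr0_norm ?chi_gt0 // -/d dE.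
have dw : d i ^+ 2 = w%:R by rewrite dE wE rmorph_nat.
by exists w => //; rewrite -(ltr0n K) -dw.
Qed.

Lemma codegree_nat l : exists k : nat, n l = k%:R.
Proof.
have [w wE w0] := dimsq_nat l.
have w0' : w%:R != 0 :> K by rewrite pnatr_eq0 -lt0n.
have nE : n l = ratr (D%:R / w%:R).
  by rewrite fmorph_div !rmorph_nat -(codegree_mul_dimsq l) wE mulfK.
have [||k kE] := @rat_algint_nat K (D%:R / w%:R).
- by rewrite divr_ge0 ?ler0n.
- suff: algint K (n l) by rewrite nE.
  by apply: algint_sum => i; exact: algint_normsq.
by exists k; rewrite nE kE rmorph_nat.
Qed.

Section Divisibility.
Variable w : 'I_m -> nat.
Hypothesis w_def : forall i, d i ^+ 2 = (w i)%:R.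

Lemma dimsq_gt0 i : (0 < w i)%N.
Proof. by rewrite -(ltr0n K) -w_def exprn_gt0 ?chi_gt0. Qed.

Lemma dimsq_neq0 i : (w i)%:R != 0 :> K.
Proof. by rewrite pnatr_eq0 -lt0n dimsq_gt0. Qed.

Lemma sum_dimsq : (\sum_i w i = D)%N.
Proof.
apply/eqP; rewrite -(eqr_nat K) -D_def natr_sum; apply/eqP.
by apply: eq_bigr => i _; rewrite -w_def.
Qed.

Lemma dimsq_le i : (w i <= D)%N.
Proof. by rewrite -sum_dimsq (bigD1 i) //= leq_addr. Qed.

Lemma codegree_dimsq l : n l = D%:R / (w l)%:R.
Proof. by rewrite -(codegree_mul_dimsq l) w_def mulfK ?dimsq_neq0. Qed.

Lemma dimsq_dvd l : (w l %| D)%N.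
Proof.
have [k nk] := codegree_nat l; apply/dvdnP; exists k.
by apply/eqP; rewrite -(eqr_nat K) natrM -nk -w_def codegree_mul_dimsq.
Qed.

(** The exponent varies with l, but n_l = D / w_l determines it. The function is a product over all
    possible values v, whose factor is the v-th power where w_l = v and 1 elsewhere. *)
Lemma ratl_pow_dim i : ratl chi (fun l => (`|chi l i| ^+ 2) ^+ w l).
Proof.
pose F (v : 'I_D.+1) l : K := (n l == ratr (D%:R / v%:R))%:R.
have FE v l : F v l = (w l == v)%:R.
  congr (nat_of_bool _)%:R; rewrite fmorph_div !rmorph_nat codegree_dimsq /=.
  have [-> //|] := eqVneq (w l) v; first by rewrite eqxx.
  apply: contraNF => /eqP /(mulfI global_dim_neq0) /invr_inj /eqP.
  by rewrite eqr_nat.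
have F_rat v : ratl chi (F v) by apply: ratl_indicator => //; exact: ratl_codegree.
have G_rat v : ratl chi (fun l => F v l * ((`|chi l i| ^+ 2) ^+ v - 1) + 1).
  have one : ratl chi (fun=> 1) by apply: eq_ratl (ratl_const chi 1) => l; rewrite rmorph1.
  have mone : ratl chi (fun=> -1).
    by apply: eq_ratl (ratl_const chi (-1)) => l; rewrite rmorphN1.
  apply: ratlD one; apply: ratlM (F_rat v) _.
  by apply: ratlD mone; apply: ratl_exp; exact: ratl_normsq.
apply: eq_ratl (ratl_prod G_rat) => l.
rewrite (bigD1 (inord (w l))) //= FE inordK ?ltnS ?dimsq_le // eqxx mul1r subrK.
rewrite big1 ?mulr1 // => v; rewrite FE; case: (w l =P v) => [->|_ _].
  by rewrite inord_val eqxx.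
by rewrite mul0r add0r.
Qed.

(* If the l-th character has no zero, then the product of the algebraic
   integers t i with multiplicities w i is a positive integer, while their
   weighted mean is 1; by AM-GM they are all equal to 1, but t l0 = w l. *)
Lemma burnside_zero l : d l != 1 -> exists i, chi l i = 0.
Proof.
move=> dl; apply: contrapT => /forallNP chi0.
pose t i := `|chi i l| ^+ 2.
(* Symmetry passes from column l of the table to row l. *)
have tw i : t i * (w i)%:R = `|chi l i| ^+ 2 * (w l)%:R.
  by rewrite -!w_def -!chi_e_norm -!exprMn -!normrM chi_sym.
have t_gt0 i : 0 < t i.
  rewrite lt0r exprn_ge0 // andbT; apply/eqP => ti0; case: (chi0 i).
  have /esym/eqP := tw i; rewrite ti0 mul0r mulf_eq0 (negPf (dimsq_neq0 l)) orbF.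
  by rewrite expf_eq0 normr_eq0 => /eqP.
have prod_ge1 : 1 <= \prod_i t i ^+ w i.
  have P_gt0 : 0 < \prod_i t i ^+ w i by apply: prodr_gt0 => i _; rewrite exprn_gt0.
  have [q qE] := ratl_prod_rat chi_indep (ratl_pow_dim l).
  have Pint : algint K (\prod_i t i ^+ w i).
    by apply: algint_prod => i; apply: algint_exp; exact: algint_normsq.
  rewrite -/(t _) in qE.
  have [||k kE] := @rat_algint_nat K q.
  - by rewrite -(ler0q K) -qE ltW.
  - by rewrite -qE.
  by move: P_gt0; rewrite qE kE rmorph_nat ltr0n ler1n.
(* Repeating i exactly w i times turns the weighted inequality into the plain one, [leif_AGM]. *)
pose A := [pred x : 'I_m * 'I_D.+1 | (x.2 < w x.1)%N].
have card_inner i : #|[pred k : 'I_D.+1 | (k < w i)%N]| = w i.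
  by rewrite -sum1_card (big_ord_narrow (leqW (dimsq_le i))) sum1_card card_ord.
have cardA : #|A| = D.
  transitivity (\sum_i w i)%N; last exact: sum_dimsq.
  rewrite -sum1_card (eq_bigl (fun x : 'I_m * 'I_D.+1 => true && (x.2 < w x.1)%N)) //.
  rewrite -(pair_big_dep xpredT (fun i (k : 'I_D.+1) => (k < w i)%N) (fun _ _ => 1%N)) /=.
  by apply: eq_bigr => i _; rewrite sum1_card card_inner.
have prodA : \prod_(x in A) t x.1 = \prod_i t i ^+ w i.
  rewrite (eq_bigl (fun x : 'I_m * 'I_D.+1 => true && (x.2 < w x.1)%N)) //.
  rewrite -(pair_big_dep xpredT (fun i (k : 'I_D.+1) => (k < w i)%N) (fun i _ => t i)) /=.
  by apply: eq_bigr => i _; rewrite prodr_const card_inner.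
have sumA : \sum_(x in A) t x.1 = D%:R.
  rewrite (eq_bigl (fun x : 'I_m * 'I_D.+1 => true && (x.2 < w x.1)%N)) //.
  rewrite -(pair_big_dep xpredT (fun i (k : 'I_D.+1) => (k < w i)%N) (fun i _ => t i)) /=.
  transitivity (\sum_i `|chi l i| ^+ 2 * (w l)%:R).
    by apply: eq_bigr => i _; rewrite sumr_const card_inner -tw mulr_natr.
  by rewrite -mulr_suml -[\sum_i _]/(n l) -w_def codegree_mul_dimsq.
have := @leif_AGM K _ A (fun x => t x.1) (fun x _ => ltW (t_gt0 x.1)).
rewrite /= prodA cardA sumA divff ?global_dim_neq0 // expr1n => -[P_le1 Peq].
have : \prod_i t i ^+ w i == 1 by rewrite eq_le P_le1.
rewrite Peq => /forall_inP teq.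
have t_const i : t i = t l0.
  have inA j : (j, ord0) \in A by rewrite inE /= dimsq_gt0.
  by have /forall_inP/(_ _ (inA l0))/eqP := teq _ (inA i).
have tl0 : t l0 * D%:R = D%:R.
  rewrite -{1}sum_dimsq natr_sum mulr_sumr -[RHS](codegree_mul_dimsq l) w_def -/n /n /codegree mulr_suml.
  by apply: eq_bigr => i _; rewrite -(t_const i) tw.
have {}tl0 : t l0 = 1 by apply: (mulIf global_dim_neq0); rewrite tl0 mul1r.
case/eqP: dl; move: tl0; rewrite /t gtr0_norm ?chi_gt0 // => /eqP.
by rewrite sqrp_eq1 ?ltW ?chi_gt0 // => /eqP.
Qed.

Let G := #|[pred i | w i == 1%N]|.

Lemma invertible_decomposition :
  exists a : nat, (D = G * a)%N /\ (D %| G * \prod_i w i)%N.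
Proof.
pose G_char l := [forall i, `|chi l i| == d i].
have GP l : G_char l = (w l == 1%N).
  apply/forallP/eqP => [Gl|wl i].
    have nl : n l = D%:R.
      by rewrite -codegree_dim; apply: eq_bigr => i _; rewrite (eqP (Gl i)) gtr0_norm.
    have /eqP := codegree_mul_dimsq l; rewrite nl w_def -[X in _ == X]mulr1.
    by rewrite (inj_eq (mulfI global_dim_neq0)) pnatr_eq1 => /eqP.
  by apply/eqP/codegree_max_norm; rewrite codegree_dimsq wl divr1.
(* Stands in for C_ad, defined through characters: the classes on which every character of modulus d
   agrees with d. *)
pose ad i := [forall l, G_char l ==> (chi l i == d i)].
have adP i : reflect (forall l, G_char l -> chi l i = d i) (ad i).
  by apply: (iffP forallP) => h l; [move/implyP: (h l) => h' /h'/eqP|apply/implyP => /h ->].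
have hb l : (exists i, chi l i = 0) \/ (forall i, `|chi l i| = d i).
  have [Gl|nGl] := boolP (G_char l); first by right=> i; apply/eqP; exact: (forallP Gl).
  left; apply: burnside_zero; apply: contraNneq nGl => dl; rewrite GP.
  by rewrite -(pnatr_eq1 K) -w_def dl expr1n.
have [|||||y [yc yE]] := burnside_coef hN (hchi l0) chi_gt0 hchi chi_indep (ad := ad) _ _ _ _ _ hb.
- by apply/adP => l _; rewrite (hchi l).1 /d (hchi l0).1.
- move=> i /adP adi; apply/adP => l Gl.
  exact: (char_eq_dim_st hN (hchi l0) chi_gt0 (hchi l) (adi l Gl)).
- move=> i j l /adP adi /adP adj Nl; apply/adP => l' Gl.
  apply: (char_eq_dim_prod hN (hchi l0) chi_gt0 (hchi l') _ Nl).
  by rewrite adi // adj.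
- move=> i l Nl; apply/adP => l' Gl.
  apply: (char_eq_dim_adjoint hN (hchi l0) chi_gt0 (hchi l') _ Nl).
  by apply/eqP; exact: (forallP Gl).
- by move=> l Gl i /adP; apply; apply/forallP => j; rewrite Gl.
pose a := (\sum_(i | ad i) w i)%N.
have prodE : (\prod_i w i = y e * a)%N.
  apply/eqP; rewrite -(eqr_nat K) natrM natr_prod natr_sum; apply/eqP.
  under eq_bigr do rewrite -w_def.
  by rewrite yE; congr (_ * _); apply: eq_bigr => i _; rewrite w_def.
(* Evaluate \sum_l d_l^2 chi_l(y) twice: column orthogonality keeps only the coefficient at 1, while
   only the G characters without zeros contribute, each with weight 1 and value \prod_i w i. *)
have yD : (y e * D = G * \prod_i w i)%N.
  apply/eqP; rewrite -(eqr_nat K) !natrM; apply/eqP.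
  transitivity (\sum_l `|chi e l| ^+ 2 * \sum_i (y i)%:R * chi l i).
    under [RHS]eq_bigr do rewrite mulr_sumr.
    rewrite exchange_big /=.
    under [RHS]eq_bigr => i _ do under eq_bigr => l _ do rewrite mulrCA.
    under [RHS]eq_bigr => i _ do
      rewrite -mulr_sumr (chi_orth_col hN hchi chi_indep chi_sym chi_e_neq0).
    rewrite (bigD1 e) //= eqxx mulr1n -/n codegree_e big1 ?addr0 // => i /negPf ->.
    by rewrite mulr0.
  rewrite /G -sum1_card natr_sum mulr_suml [RHS]big_mkcond /=; apply: eq_bigr => l _.
  rewrite yc // chi_e_norm w_def inE -GP; case: ifP => [Gl|nGl].
    have := GP l; rewrite Gl => /esym/eqP ->; congr (_ * _).
    rewrite natr_prod; apply: eq_bigr => i _.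
    by rewrite (char_normsq hN i (hchi l)) (eqP (forallP Gl i)) w_def.
  have [[i ci]|Gl] := hb l; first by rewrite (bigD1 i) //= ci !mul0r mulr0.
  by have /negP[] := negbT nGl; apply/forallP => i; rewrite Gl.
have y0 : (0 < y e)%N.
  have : (0 < \prod_i w i)%N by apply: prodn_gt0 => i; exact: dimsq_gt0.
  by rewrite prodE muln_gt0 => /andP[].
exists a; split; last by rewrite -yD dvdn_mull.
by apply/eqP; rewrite -(eqn_pmul2l y0) yD prodE mulnCA.
Qed.

End Divisibility.
End WeaklyIntegral.

(** * Fusion subcategories *)

Lemma sum_nat_neq0 (I : finType) (F : I -> nat) :
  (\sum_i F i)%N != 0%N -> exists i, F i != 0%N.
Proof.
move=> s0; apply: contrapT => /forallNP F0; case/eqP: s0; apply: big1 => i _.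
by have /negP/negPn/eqP := F0 i.
Qed.

Section FusionSubcategories.
Variables (R : realType) (C : fusionCat R[i]%C) (m : nat) (X : 'I_m -> C).
Hypothesis hX : simple_reps X.
Variables (e : 'I_m) (st : 'I_m -> 'I_m).
Notation N := (fun i j l => mult X l (X i ⊗ X j)).
Hypothesis hN : fusion_rules N e st.
Hypothesis Xe : isomorphic (X e) munit.
Implicit Types Y Z : C.

Let Cab : abelian_cat C := fus_abelian C.

Lemma isomorphic_simple Y Z : isomorphic Y Z -> simple Z -> simple Y.
Proof.
move=> [f [g [gf fg]]] [Z0 Zs]; split=> [[Y0 _]|A i imono].
  by apply: Z0; apply: idm_eq0_zero; rewrite -fg (Y0 _ f) comp0l.
have [| |[j [jfi fij]]] := Zs _ (f ∘ i).
- move=> B u v; rewrite -!compA => /(congr1 (fun h => g ∘ h)).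
  by rewrite !compA gf !comp1m => /imono.
- by left.
right; exists (j ∘ f); split; first by rewrite -compA.
by apply: (comp_cancel_l gf); rewrite compm1 -[RHS]comp1m -fij -!compA.
Qed.

Lemma mult_unit l : mult X l munit = (l == e).
Proof. by rewrite -(mult_iso X l Xe) mult_simple. Qed.

Lemma simple_unit : simple (munit : C).
Proof.
have [sX _ _] := hX.
exact: isomorphic_simple (isomorphic_sym Xe) (sX e).
Qed.

Lemma mult_dual l Y : mult X l Y^∨ = mult X (st l) Y.
Proof.
rewrite -(dim_hom_to_simple hX).
have -> : \dim {: hom Y^∨ (X l)} = \dim {: hom (Y^∨ ⊗ munit) (X l)}.
  by apply: dim_hom_iso_l; exists (runiti _), (runit _); rewrite runitK runitiK.
rewrite (dim_hom_dual munit (X l) (dpair_of (ldualP Y))) -(dim_hom_iso_l _ Xe).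
rewrite -[LHS]/(mult X e (Y ⊗ X l)) mult_tens //.
rewrite (bigD1 (st l)) //= [X in (_ + X)%N]big1 ?addn0.
  rewrite (bigD1 l) //= big1 ?addn0 => [|j /negPf jl].
    by rewrite mult_simple // eqxx (N_unit hN) (st_invol hN) eqxx !muln1.
  by rewrite mult_simple // jl muln0.
move=> i il; rewrite big1 // => j _; rewrite (N_unit hN) mult_simple //.
case: (j =P l) => [->|_]; last by rewrite muln0.
by case: (l =P st i) il => [-> |_]; rewrite ?muln0 // (st_invol hN) eqxx.
Qed.

Lemma isomorphic_dual k Y : isomorphic Y (X k) -> isomorphic (X (st k)) Y^∨.
Proof.
move=> Yk; apply: mult_sum1_iso => // [|j /negPf jk].
  by rewrite mult_dual (mult_iso X _ Yk) mult_simple // (st_invol hN) eqxx.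
rewrite mult_dual (mult_iso X _ Yk) mult_simple //; case: eqP => // jE.
by rewrite -jE (st_invol hN) eqxx in jk.
Qed.

Lemma mult_neq0P l Y : reflect (exists f : hom (X l) Y, f <> 0) (mult X l Y != 0%N).
Proof.
apply: (iffP idP) => [|[f f0]].
  move=> /dimv_eq0P Y0; apply: contrapT => /forallNP nf; apply: Y0 => f.
  exact: contrapT (nf f).
by apply/dimv_eq0P => Y0; exact: f0 (Y0 f).
Qed.

Lemma mult_mono l Y Z (i : hom Y Z) : is_mono i -> mult X l Y != 0%N -> mult X l Z != 0%N.
Proof.
move=> imono /mult_neq0P[f f0]; apply/mult_neq0P; exists (i ∘ f) => if0.
by apply: f0; apply: imono; rewrite if0 comp0r.
Qed.

Lemma gen_subcat_fusion (G : C -> Prop) : fusion_subcat (gen_subcat G).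
Proof.
split=> [D [h1 _ _ _ _] _ //|Y Z gY gZ D hD GD|Y gY D hD GD|n S Y gS SY D hD GD|Y Z i imono gY D hD GD];
  have [_ h2 h3 h4 h5] := hD.
- by apply: h2; [exact: gY|exact: gZ].
- by apply: h3; exact: gY.
- by apply: h4 SY => i; exact: gS.
- by apply: h5 imono _; exact: gY.
Qed.

Lemma fusion_subcat_constituent (D : C -> Prop) l Y :
  fusion_subcat D -> D Y -> mult X l Y != 0%N -> D (X l).
Proof.
move=> [_ _ _ _ hsub] DY /mult_neq0P[f f0].
by have [sX _ _] := hX; apply: hsub (simple_mono Cab (sX l) f0) DY.
Qed.

(** Test subcategories: a generated subcategory lies in every fusion subcategory containing its
    generators, so conditions on the fusion rules bound C_ad and C_pt from above. *)
Lemma constituents_fusion_subcat (P : 'I_m -> Prop) :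
  P e -> (forall i, P i -> P (st i)) ->
  (forall i j l, P i -> P j -> N i j l != 0%N -> P l) ->
  fusion_subcat (fun Y => forall l, mult X l Y != 0%N -> P l).
Proof.
move=> Pe Pst Pprod; split=> [l|Y Z PY PZ l|Y PY l|n S Y PS SY l|Y Z i imono PY l].
- by rewrite mult_unit; case: (l =P e) => [->|].
- rewrite mult_tens // => /sum_nat_neq0[a] /sum_nat_neq0[b].
  rewrite !muln_eq0 !negb_or -andbA.
  by move=> /and3P[/PY Pi /PZ Pj]; exact: Pprod Pi Pj.
- by rewrite mult_dual => /PY /Pst; rewrite (st_invol hN).
- by rewrite (mult_direct_sum X l SY) => /sum_nat_neq0[a]; exact: PS.
- by move=> /(mult_mono imono) /PY.
Qed.

Lemma ev_neq0 Y : simple Y -> ev Y <> 0.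
Proof.
move=> [Y0 _] ev0; apply: Y0; apply: idm_eq0_zero.
have [<- _] := ldualP Y; rewrite ev0 tensm0r comp0r !comp0l.
by [].
Qed.

Lemma coev_neq0 Y : simple Y -> coev Y <> 0.
Proof.
move=> [Y0 _] ev0; apply: Y0; apply: idm_eq0_zero.
have [<- _] := ldualP Y; rewrite ev0 tensm0l comp0r !comp0l.
by [].
Qed.

Hypothesis Xst : forall i, isomorphic (X (st i)) (X i)^∨.

(** Both products contain 1 exactly once, so the right side makes them isomorphic to 1. Then [ev]
    and [coev] are nonzero maps between simple objects, and Schur's lemma applies. *)
Lemma invertible_simpleP i :
  invertible (X i) <-> forall l, l != e -> N i (st i) l = 0%N /\ N (st i) i l = 0%N.
Proof.
have [sX _ _] := hX.
have isoR : isomorphic (X i ⊗ X (st i)) (X i ⊗ (X i)^∨).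
  exact: isomorphic_tens (isomorphic_refl _) (Xst i).
have isoL : isomorphic (X (st i) ⊗ X i) ((X i)^∨ ⊗ X i).
  exact: isomorphic_tens (Xst i) (isomorphic_refl _).
split=> [[evi coevi] l le|N0].
  have evI : isomorphic ((X i)^∨ ⊗ X i) munit by exists (ev (X i)).
  have coevI : isomorphic munit (X i ⊗ (X i)^∨) by exists (coev (X i)).
  rewrite (mult_iso X l isoR) (mult_iso X l isoL) -(mult_iso X l coevI).
  by rewrite (mult_iso X l evI) mult_unit (negPf le).
have simpleL : simple ((X i)^∨ ⊗ X i).
  apply: isomorphic_simple (isomorphic_sym _) (sX e).
  apply: isomorphic_trans _ isoL; apply: mult_sum1_iso => // [|j je]; last by case: (N0 j je).
  by rewrite (N_unit hN) (st_invol hN) eqxx.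
have simpleR : simple (X i ⊗ (X i)^∨).
  apply: isomorphic_simple (isomorphic_sym _) (sX e).
  apply: isomorphic_trans _ isoR; apply: mult_sum1_iso => // [|j je]; last by case: (N0 j je).
  by rewrite (N_unit hN) eqxx.
split; first exact: simple_iso simpleL simple_unit (ev_neq0 (sX i)).
exact: simple_iso simple_unit simpleR (coev_neq0 (sX i)).
Qed.

End FusionSubcategories.

Section CharacterTable.
Variables (K : numClosedFieldType) (m : nat) (N : 'I_m -> 'I_m -> 'I_m -> nat).
Variables (e : 'I_m) (st : 'I_m -> 'I_m).
Hypothesis hN : fusion_rules N e st.

(** The Gram matrix is diagonal with the positive codegrees as entries. *)
Lemma distinct_chars_indep (chi : 'I_m -> 'I_m -> K) :
  (forall l, fusion_char N e (chi l)) ->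
  (forall l l', l != l' -> exists i, chi l i != chi l' i) ->
  \matrix_(l, i) chi l i \in unitmx.
Proof.
move=> hchi chi_neq; set V := \matrix_(l, i) _.
have VV : V *m (map_mx Num.conj V)^T = diag_mx (\row_l codegree chi l).
  apply/matrixP => l l'; rewrite !mxE.
  under eq_bigr do rewrite !mxE.
  have [<-|ll'] := eqVneq l l'; first by rewrite mulr1n codegreeE.
  by rewrite mulr0n (char_orth hN (hchi l) (hchi l') (chi_neq l l' ll')).
have : \det (V *m (map_mx Num.conj V)^T) != 0.
  rewrite VV det_diag; apply/prodf_neq0 => l _; rewrite mxE.
  exact: lt0r_neq0 (codegree_gt0 hchi l).
by rewrite det_mulmx mulf_eq0 negb_or => /andP[detV _]; rewrite unitmxE unitfE.
Qed.

End CharacterTable.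

Section GrothendieckRing.
Variables (R : realType) (C : fusionCat R[i]%C) (m : nat) (X : 'I_m -> C).
Hypothesis hX : simple_reps X.
Variables (e : 'I_m) (st : 'I_m -> 'I_m).
Notation N := (fun i j l => mult X l (X i ⊗ X j)).
Hypothesis hN : fusion_rules N e st.
Hypothesis Xe : isomorphic (X e) munit.
Hypothesis Xst : forall i, isomorphic (X (st i)) (X i)^∨.
Local Notation b := (groth_basis R).

Lemma groth_classE (Y : C) : groth_class X Y = \sum_l (mult X l Y)%:R *: b l.
Proof.
apply/rowP => l; rewrite mxE summxE (bigD1 l) //= big1 => [|j /negPf jl].
  by rewrite !mxE !eqxx mulr1 addr0.
by rewrite !mxE eq_sym jl andbF mulr0.
Qed.

Lemma groth_class_iso (Y Z : C) : isomorphic Y Z -> groth_class X Y = groth_class X Z.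
Proof. by move=> YZ; apply/rowP => l; rewrite !mxE (mult_iso X l YZ). Qed.

Lemma groth_class_simple i : groth_class X (X i) = b i.
Proof. by apply/rowP => l; rewrite !mxE mult_simple. Qed.

Lemma groth_mul_basis i j : groth_mul X (b i) (b j) = groth_class X (X i ⊗ X j).
Proof.
rewrite /groth_mul (bigD1 i) //= (bigD1 j) //= !mxE !eqxx mulr1 scale1r.
rewrite !big1 ?addr0 // => [i' /negPf i'i|j' /negPf j'j].
  by rewrite big1 // => j' _; rewrite !mxE i'i andbF mul0r scale0r.
by rewrite !mxE j'j andbF mulr0 scale0r.
Qed.

Lemma algebra_morphism_char (f : groth_dual R m) :
  algebra_morphism X f -> fusion_char N e (fun i => f (b i)).
Proof.
move=> [f1 fM]; split; first by rewrite -f1 -(groth_class_iso Xe) groth_class_simple.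
move=> i j; rewrite -fM groth_mul_basis groth_classE linear_sum.
by apply: eq_bigr => l _; rewrite linearZ.
Qed.

Lemma groth_dual_ext (f g : groth_dual R m) : (forall i, f (b i) = g (b i)) -> f = g.
Proof.
move=> fg; apply/lfunP => u; rewrite (row_sum_delta u) !linear_sum.
by apply: eq_bigr => i _; rewrite !linearZ; congr (_ *: _); exact: fg.
Qed.

Lemma FPdim_obj_ge0 (Y : C) : 0 <= FPdim_obj X Y.
Proof.
(* Without a supremum, [sup] takes the default value 0. *)
rewrite /FPdim_obj; set S := (X in sup X); have [supS|nsup] := pselect (has_sup S); last by rewrite sup_out.
have [[a Sa] _] := supS; have [a0 _] := Sa.
by apply: le_trans a0 _; apply: ub_le_sup => //; exact: supS.2.
Qed.

Lemma FPdim_sub_gt0 (D : C -> Prop) : D (X e) -> 0 < FPdim_simple X e -> 0 < FPdim_sub X D.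
Proof.
move=> De d0; rewrite /FPdim_sub (bigD1 e) /=; last exact/asboolP.
by rewrite ltr_pwDl ?exprn_gt0 // sumr_ge0 // => i _; rewrite sqr_ge0.
Qed.

Lemma dual_Burnside_integral : dual_Burnside X ->
  (\prod_(i < m) FPdim_simple X i) ^+ 2 / FPdim_sub X (adjoint_subcat (C := C))
    \is a Num.int.
Proof.
move=> [mu [j1 [[mu_uniq mu_char mu1] mu_burnside]]].
pose chi l i : R[i]%C := tnth mu l (b i).
have hchi l : fusion_char N e (chi l).
  by apply: algebra_morphism_char; apply/mu_char; exact: mem_tnth.
have chi_indep : \matrix_(l, i) chi l i \in unitmx.
  apply: (distinct_chars_indep hN hchi) => l l' ll'.
  apply: contrapT => /forallNP ll'E; case/eqP: ll'.
  apply/(tuple_uniqP _ mu_uniq)/groth_dual_ext => i.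
  by have /negP/negPn/eqP := ll'E i.
pose d i : R[i]%C := (FPdim_simple X i)%:C%C.
have dE : chi j1 = d.
  by apply/funext => i; rewrite /chi mu1 extendE.
have hd : fusion_char N e d by rewrite -dE.
have d_gt0 : forall i, 0 < d i.
  by apply: (char_nonneg_gt0 hN hd) => i; rewrite lecR FPdim_obj_ge0.
have grouplike l : dual_grouplike X mu j1 l -> forall i, `|chi l i| = d i.
  rewrite /dual_grouplike /=; set c := coord _ _ _ => prodE i.
  have starE k : chi l k * chi l (st k) / d k = c * d k.
    have := congr1 (fun f : groth_dual R m => f (b k)) prodE.
    rewrite extendE [sharp _ _ _]extendE scale_lfunE mu1 extendE.
    by rewrite -(groth_class_iso (Xst k)) groth_class_simple.
  (* Evaluation at the unit object fixes the constant. *)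
  have c1 : c = 1.
    by have := starE e; rewrite hd.1 (char_st hN e (hchi l)) (hchi l).1 conjC1 !mulr1 divr1.
  have := starE i; rewrite c1 mul1r (char_normsq hN i (hchi l)) => /(canRL (divfK _)).
  rewrite lt0r_neq0 // => /(_ isT) /eqP; rewrite -expr2 eqrXn2 ?normr_ge0 ?ltW //.
  by move=> /eqP.
have hb l : (exists i, chi l i = 0) \/ (forall i, `|chi l i| = d i).
  have [gl|ngl] := pselect (dual_grouplike X mu j1 l); first by right; exact: grouplike.
  by left; apply/mu_burnside.
pose D := adjoint_subcat (C := C); have hD : fusion_subcat D by exact: gen_subcat_fusion.
have [D1 Dtens Ddual _ _] := hD.
have [sX _ _] := hX.
have DE Y l : D Y -> mult X l Y != 0%N -> D (X l).
  exact: fusion_subcat_constituent.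
pose ad : pred 'I_m := fun i => `[< D (X i) >].
have ade : D (X e) by apply: (DE munit) => //; rewrite (mult_unit hX Xe) eqxx.
have [|||||y [_ yE]] := burnside_coef hN hd d_gt0 hchi chi_indep (ad := ad) _ _ _ _ _ hb.
- exact/asboolP.
- move=> i /asboolP Di; apply/asboolP; apply: (DE _ _ (Ddual _ Di)).
  by rewrite -(mult_iso X _ (Xst i)) mult_simple // eqxx.
- by move=> i j l /asboolP Di /asboolP Dj Nl; apply/asboolP; exact: DE (Dtens _ _ Di Dj) Nl.
- move=> i l Nl; apply/asboolP; apply: (DE (X i ⊗ (X i)^∨)).
    by move=> D' hD' GD; apply: GD; exists (X i).
  by rewrite -(mult_iso X l (isomorphic_tens (isomorphic_refl (X i)) (Xst i))).
- move=> l chil i /asboolP Di.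
  (* Test C_ad against the objects on whose constituents [chi l] agrees with FPdim. *)
  have := Di (fun Y => forall j, mult X j Y != 0%N -> chi l j = d j).
  apply => [|Y [Z sZ ->] j|]; last by rewrite mult_simple // eqxx.
    apply: (constituents_fusion_subcat hX hN Xe).
    + by rewrite (hchi l).1 hd.1.
    + by move=> j; exact: (char_eq_dim_st hN hd d_gt0 (hchi l)).
    + move=> j k a cj ck Na; apply: (char_eq_dim_prod hN hd d_gt0 (hchi l) _ Na).
      by rewrite cj ck.
  have [_ _ hS] := hX; have [k Zk] := hS Z sZ.
  rewrite (mult_iso X j (isomorphic_tens Zk (isomorphic_sym (isomorphic_dual hX hN Xe Zk)))).
  by apply: (char_eq_dim_adjoint hN hd d_gt0 (hchi l)).
have DS0 : FPdim_sub X D != 0.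
  by apply/lt0r_neq0/FPdim_sub_gt0; rewrite -?ltcR //; exact: d_gt0.
suff -> : (\prod_(i < m) FPdim_simple X i) ^+ 2 = (y e)%:R * FPdim_sub X D.
  by rewrite mulfK // rpred_nat.
apply: (@complexI R); rewrite rmorphXn rmorphM rmorph_prod rmorph_nat /= /FPdim_sub.
rewrite rmorph_sum -prodrXl yE; congr (_ * _); apply: eq_bigr => i _.
by rewrite rmorphXn.
Qed.

End GrothendieckRing.

(** * Modular categories *)

Section VerlindeCharacters.
Variables (R : realType) (C : modularCat R[i]%C) (m : nat) (X : 'I_m -> C).
Hypothesis hX : simple_reps X.
Variables (e : 'I_m) (st : 'I_m -> 'I_m).
Notation N := (fun i j l => mult X l (X i ⊗ X j)).
Hypothesis hN : fusion_rules N e st.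
Hypothesis Xe : isomorphic (X e) munit.

Lemma encircle_scalar i (Z : C) :
  exists a, forall W, encircle Z (X i) W = a *: idm (X i ⊗ W).
Proof.
have [t tE] := wtrans_rep (encircle_wtrans Z (X i)).
have [sX _ _] := hX.
have [a ta] := simple_endo (fus_abelian C) t (sX i).
by exists a => W; rewrite tE ta tensmZl tensm_id.
Qed.

Definition verlinde i (Z : C) := sval (cid (encircle_scalar i Z)).

Lemma verlindeP i Z W : encircle Z (X i) W = verlinde i Z *: idm (X i ⊗ W).
Proof. exact: (svalP (cid (encircle_scalar i Z))). Qed.

Lemma verlinde_uniq i Z a :
  encircle Z (X i) munit = a *: idm (X i ⊗ munit) -> verlinde i Z = a.
Proof.
rewrite verlindeP => /eqP; rewrite -subr_eq0 -scalerBl scaler_eq0 subr_eq0.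
case/orP=> /eqP // id0; have [sX _ _] := hX; case: (sX i) => [[]].
apply: idm_eq0_zero; rewrite -(runitiK (X i)) -[runit _]compm1 id0.
by rewrite comp0r comp0l.
Qed.

Lemma verlinde_tens i Y Z : verlinde i (Y ⊗ Z) = verlinde i Y * verlinde i Z.
Proof.
apply: verlinde_uniq; rewrite encircle_tens verlindeP.
rewrite tensmZr tensm_id compZr compm1 compZl compZr compZl -encircleE verlindeP.
by rewrite scalerA mulrC.
Qed.

Lemma verlinde_direct_sum i n (S : 'I_n -> C) Z :
  is_direct_sum S Z -> verlinde i Z = \sum_j verlinde i (S j).
Proof.
move=> SZ; apply: verlinde_uniq; rewrite (encircle_direct_sum _ _ SZ) scaler_suml.
by apply: eq_bigr => j _; rewrite verlindeP.
Qed.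

Let chi i j := verlinde i (X j).

Lemma SmatrixE i j : Smatrix X i j = chi i j * qdim (X i).
Proof. by rewrite mxE; apply: qtrace_braid => W; rewrite verlindeP. Qed.

Lemma Smatrix_sym i j : Smatrix X i j = Smatrix X j i.
Proof. by rewrite !mxE qtrace_cycle. Qed.

Lemma Smatrix_row_neq0 i : exists j, Smatrix X i j != 0.
Proof.
apply: contrapT => /forallNP S0.
have : row i (Smatrix X) = 0.
  by apply/rowP => j; rewrite mxE [RHS]mxE; have /negP/negPn/eqP := S0 j.
rewrite rowE => /(congr1 (fun v => v *m invmx (Smatrix X))).
rewrite mulmxK ?(Smatrix_unit hX) // mul0mx => /rowP/(_ i)/eqP.
by rewrite !mxE !eqxx oner_eq0.
Qed.

Lemma qdim_neq0 i : qdim (X i) != 0.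
Proof.
have [j] := Smatrix_row_neq0 i; apply: contraNneq => q0.
by rewrite SmatrixE q0 mulr0.
Qed.

Lemma verlinde_mul i j k : chi i j * chi i k = \sum_l (N j k l)%:R * chi i l.
Proof.
rewrite -verlinde_tens (additive_expand hX _ (verlinde_direct_sum i)).
by apply: eq_bigr => l _; rewrite mulr_natl.
Qed.

Lemma verlinde_char i : fusion_char N e (chi i).
Proof.
split; last exact: verlinde_mul.
(* The value at 1 comes from x_e x_j = x_j, given a j with chi i j != 0; invertibility of S provides
   one. *)
have [j Sij] := Smatrix_row_neq0 i.
have chij : chi i j != 0 by apply: contraNneq Sij => c0; rewrite SmatrixE c0 mul0r.
apply: (mulIf chij); rewrite verlinde_mul mul1r (bigD1 j) //= (N1l hN) eqxx mul1r.
by rewrite big1 ?addr0 // => l /negPf jl; rewrite (N1l hN) eq_sym jl mul0r.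
Qed.

Lemma verlinde_e j : chi e j = qdim (X j) / qdim (X e).
Proof.
apply: (mulIf (qdim_neq0 e)); rewrite divfK ?qdim_neq0 //.
by rewrite -SmatrixE Smatrix_sym SmatrixE (verlinde_char j).1 mul1r.
Qed.

Lemma verlinde_e_neq0 j : chi e j != 0.
Proof. by rewrite verlinde_e mulf_neq0 ?invr_eq0 ?qdim_neq0. Qed.

Lemma verlinde_sym i j : chi i j * chi e i = chi j i * chi e j.
Proof. by rewrite !verlinde_e !mulrA -!SmatrixE Smatrix_sym. Qed.

Lemma verlinde_indep : \matrix_(l, i) chi l i \in unitmx.
Proof.
have := Smatrix_unit hX.
have -> : Smatrix X = diag_mx (\row_i qdim (X i)) *m \matrix_(l, i) chi l i.
  by apply/matrixP => i j; rewrite mul_diag_mx SmatrixE !mxE mulrC.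
by rewrite unitmx_mul => /andP[].
Qed.

End VerlindeCharacters.

Section FrobeniusPerron.
Variables (R : realType) (C : fusionCat R[i]%C) (m : nat) (X : 'I_m -> C).
Hypothesis hX : simple_reps X.
Variables (e : 'I_m) (st : 'I_m -> 'I_m).
Notation N := (fun i j l => mult X l (X i ⊗ X j)).
Hypothesis hN : fusion_rules N e st.

(** A positive character is a left and a right eigenvector of every fusion matrix. As a left one it
    shows that c i is an eigenvalue; paired as a right one with the moduli of another eigenvector,
    it bounds all nonnegative eigenvalues by c i. *)
Lemma FPdim_of_positive_char (c : 'I_m -> R[i]%C) :
  fusion_char N e c -> (forall i, 0 < c i) ->
  forall i, c i = (FPdim_simple X i)%:C%C.
Proof.
move=> hc c_gt0; pose d i : R := complex.Re (c i).
have cE i : c i = (d i)%:C%C.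
  by apply/esym/RRe_real/gtr0_real.
have d_gt0 i : 0 < d i by have := c_gt0 i; rewrite cE ltcR.
have d_row i l : \sum_j (N i j l)%:R * d j = d i * d l.
  apply: (@complexI R); rewrite rmorph_sum rmorphM /= -!cE.
  rewrite -(dim_prod_row hN hc c_gt0); apply: eq_bigr => j _.
  by rewrite rmorphM rmorph_nat /= -cE.
have d_col i j : \sum_l (N i j l)%:R * d l = d i * d j.
  apply: (@complexI R); rewrite rmorph_sum rmorphM /= -!cE.
  rewrite hc.2; apply: eq_bigr => l _.
  by rewrite rmorphM rmorph_nat /= -cE.
move=> i; rewrite cE; congr (_%:C)%C; apply/esym.
rewrite /FPdim_simple /FPdim_obj; set S := (X in sup X).
have Sd : S (d i).
  split; first exact: ltW.
  apply/eigenvalueP; exists (\row_j d j); last first.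
    by apply/eqP => /rowP/(_ e)/eqP; rewrite !mxE gt_eqF.
  apply/rowP => l; rewrite !mxE -d_row; apply: eq_bigr => j _.
  by rewrite !mxE mulrC.
have Sub a : S a -> a <= d i.
  move=> [a0 /eigenvalueP[v vN v0]].
  have s0 : 0 < \sum_l `|v 0 l| * d l.
    rewrite lt0r sumr_ge0 ?andbT => [|l _]; last by rewrite mulr_ge0 ?normr_ge0 ?ltW.
    apply: contra v0; rewrite psumr_eq0 => [|l _]; last by rewrite mulr_ge0 ?normr_ge0 ?ltW.
    move=> /allP s0; apply/eqP/rowP => l; have := s0 l (mem_index_enum _).
    by rewrite mulf_eq0 normr_eq0 (gt_eqF (d_gt0 l)) orbF mxE => /eqP.
  rewrite -(ler_pM2r s0) !mulr_sumr.
  apply: (@le_trans _ _ (\sum_l (\sum_j `|v 0 j| * (N i j l)%:R) * d l)).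
    apply: ler_sum => l _; rewrite mulrA ler_pM2r // -{1}(ger0_norm a0) -normrM.
    have -> : a * v 0 l = (v *m lmulmx X (X i)) 0 l by rewrite vN mxE.
    rewrite mxE; apply: le_trans (ler_norm_sum _ _ _) _; apply: ler_sum => j _.
    by rewrite mxE normrM normr_nat.
  under eq_bigr do rewrite mulr_suml.
  rewrite exchange_big le_eqVlt /=; apply/orP; left; apply/eqP/eq_bigr => j _.
  rewrite mulrCA -d_col mulr_sumr; apply: eq_bigr => l _.
  by rewrite mulrA.
apply/le_anti/andP; split; first by apply: ge_sup => //; exists (d i).
by apply: ub_le_sup => //; exists (d i).
Qed.

End FrobeniusPerron.

Lemma prime_divisors_nat (R : realType) (n : nat) :
  prime_divisors (n%:R : R) = [set p | prime p /\ (p %| n)%N]%classic.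
Proof.
apply/seteqP; split=> p /=; last by move=> [p_pr pn]; exists n.
by move=> [n' [/eqP]]; rewrite eqr_nat => /eqP <-.
Qed.

Section WeaklyIntegralModular.
Variables (R : realType) (C : modularCat R[i]%C) (m : nat) (X : 'I_m -> C).
Hypothesis hX : simple_reps X.

Lemma weakly_integral_prime_divisors : weakly_integral X ->
  prime_divisors (FPdim_cat X) =
  (prime_divisors (FPdim_sub X (pointed_subcat (C := C))) `|`
   \bigcup_(i in [set: 'I_m]) prime_divisors (FPdim_simple X i ^+ 2))%classic.
Proof.
move=> wint; have [e [st [hN Xe Xst]]] := fusion_rules_of_cat hX.
pose chi i j := verlinde hX i (X j).
have hchi := verlinde_char hX hN.
have chi_indep := verlinde_indep hX.
have [l0 chi_gt0] := exists_positive_char hN hchi chi_indep.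
have dE := FPdim_of_positive_char hN (hchi l0) chi_gt0.
have catE : (FPdim_cat X)%:C%C = \sum_i verlinde hX l0 (X i) ^+ 2.
  by rewrite /FPdim_cat rmorph_sum; apply: eq_bigr => i _; rewrite dE rmorphXn.
have [D DE] : exists D : nat, FPdim_cat X = D%:R.
  apply/natrP; rewrite natrEint; apply/andP; split; first exact: wint.
  by apply: sumr_ge0 => i _; exact: sqr_ge0.
have D_def : \sum_i verlinde hX l0 (X i) ^+ 2 = D%:R.
  by rewrite -catE DE rmorph_nat.
have chi_sym := verlinde_sym hX hN; have chi_e := verlinde_e_neq0 hX hN.
have /choice[w wP] : forall i, exists w : nat, verlinde hX l0 (X i) ^+ 2 = w%:R.
  move=> i; have [w wE _] := dimsq_nat hN hchi chi_indep chi_gt0 D_def i.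
  by exists w.
have wE i : FPdim_simple X i ^+ 2 = (w i)%:R.
  by apply: (@complexI R); rewrite rmorphXn rmorph_nat /= -wP dE.
have wD i : (w i %| D)%N.
  exact: (dimsq_dvd hN hchi chi_indep chi_sym chi_e chi_gt0 D_def wP).
have w0 i : (0 < w i)%N by exact: (@dimsq_gt0 _ _ chi l0 chi_gt0 w wP i).
have [a [DG GD]] := invertible_decomposition hN hchi chi_indep chi_sym chi_e chi_gt0 D_def wP.
pose G := #|[pred i | w i == 1%N]|; rewrite -/G in DG GD.
have d_gt0 i : 0 < FPdim_simple X i by have := chi_gt0 i; rewrite dE ltcR.
have d_ge1 i : 1 <= FPdim_simple X i.
  by rewrite -(@expr_ge1 _ 2) // ?wE ?ler1n //; exact: ltW.
have d1 i : (w i == 1%N) = (FPdim_simple X i == 1).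
  by rewrite -(pnatr_eq1 R) -wE sqrp_eq1 ?ltW.
have d_mul i j : FPdim_simple X i * FPdim_simple X j =
    \sum_l (mult X l (X i ⊗ X j))%:R * FPdim_simple X l.
  apply: (@complexI R); rewrite rmorphM rmorph_sum /= -!dE (hchi l0).2.
  by apply: eq_bigr => l _; rewrite rmorphM rmorph_nat /= dE.
have d_st i : FPdim_simple X (st i) = FPdim_simple X i.
  by apply: (@complexI R); rewrite /= -!dE; exact: (dim_st hN (hchi l0) chi_gt0).
have de : FPdim_simple X e = 1 by apply: (@complexI R); rewrite /= -dE (hchi l0).1.
have d1_prod i j l : FPdim_simple X i = 1 -> FPdim_simple X j = 1 ->
    mult X l (X i ⊗ X j) != 0%N -> FPdim_simple X l = 1.
  move=> di dj Nl; apply/le_anti; rewrite d_ge1 andbT.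
  rewrite -[leRHS](mulr1 1) -{1}di -dj d_mul (bigD1 l) //=.
  rewrite -[leLHS]addr0 lerD // ?sumr_ge0 // => [|k _]; last by rewrite mulr_ge0 ?ler0n // ltW.
  by rewrite -[leLHS]mul1r ler_pM2r // ler1n lt0n.
(* Objects with all constituents of dimension 1 form a test subcategory for C_pt; conversely,
   dimension 1 forces invertibility. *)
have ptP i : pointed_subcat (C := C) (X i) <-> w i = 1%N.
  split=> [Pi|wi].
    apply/eqP; rewrite d1; apply/eqP.
    apply: (Pi (fun Y => forall l, mult X l Y != 0%N -> FPdim_simple X l = 1)) => [|Y [sY iY] l|].
    - apply: (constituents_fusion_subcat hX hN Xe) => // j dj.
      by rewrite d_st.
    - have [_ _ hS] := hX; have [k Yk] := hS Y sY.
      rewrite (mult_iso X l Yk) mult_simple //; case: (l =P k) => [-> _|//].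
      have isoL : isomorphic (X (st k) ⊗ X k) munit.
        apply: isomorphic_trans (isomorphic_tens (isomorphic_dual hX hN Xe Yk) _) _.
          exact: isomorphic_sym Yk.
        by exists (ev Y); case: iY.
      have /eqP := d_mul (st k) k; rewrite d_st -expr2.
      rewrite (bigD1 e) //= big1 => [|j /negPf je]; last first.
        by rewrite (mult_iso X j isoL) (mult_unit hX Xe) je mul0r.
      rewrite (mult_iso X e isoL) (mult_unit hX Xe) eqxx de mul1r addr0.
      by rewrite sqrp_eq1 ?ltW // => /eqP.
    - by rewrite mult_simple // eqxx.
  have [sX _ _] := hX.
  move=> D' hD' GD'; apply: GD'; split=> //.
  apply/(invertible_simpleP hX hN Xe Xst) => l le.
  have di : FPdim_simple X i = 1 by apply/eqP; rewrite -d1 wi.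
  (* A second constituent beside 1 would make a product of dimension 1 have dimension at least 2. *)
  have small (j k : 'I_m) : FPdim_simple X j = 1 -> FPdim_simple X k = 1 ->
      mult X e (X j ⊗ X k) = 1%N -> mult X l (X j ⊗ X k) = 0%N.
    move=> dj dk Ne; apply/eqP; apply: contraT => Nl.
    have : 1 + 1 <= FPdim_simple X j * FPdim_simple X k.
      rewrite d_mul (bigD1 e) //= (bigD1 l) //= Ne de mulr1 lerD2l.
      rewrite (d1_prod _ _ _ dj dk Nl) mulr1 -[leLHS]addr0 lerD ?ler1n ?lt0n //.
      by apply: sumr_ge0 => k' _; rewrite mulr_ge0 ?ler0n // ltW.
    by rewrite dj dk mulr1 gerDl ler10.
  have stE j k : mult X e (X j ⊗ X k) = (k == st j) := N_unit hN j k.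
  by split; apply: small; rewrite ?d_st // stE ?(st_invol hN) eqxx.
have ptE : FPdim_sub X (pointed_subcat (C := C)) = G%:R.
  rewrite /FPdim_sub /G -sum1_card natr_sum; apply: eq_big => [i|i /asboolP/ptP wi].
    by rewrite inE; apply/asboolP/eqP => /ptP.
  by rewrite wE wi.
rewrite ptE DE !prime_divisors_nat; apply/seteqP; split=> p /=.
  move=> [p_pr pD]; have := dvdn_trans pD GD; rewrite Euclid_dvdM // => /orP[pG|pw].
    by left.
  right; move: pw; rewrite Euclid_dvd_prod // big_orE => /existsP[i' /= pwi].
  by exists i' => //; rewrite wE prime_divisors_nat.
move=> [[p_pr pG]|[i _]]; first by split=> //; rewrite DG dvdn_mulr.
by rewrite wE prime_divisors_nat => -[p_pr pw]; split=> //; exact: dvdn_trans pw (wD i).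
Qed.

End WeaklyIntegralModular.

Local Open Scope complex_scope.
Local Open Scope classical_set_scope.

Theorem theorem1p19 (R : realType) :
  (forall (C : modularCat R[i]) (m : nat) (X : 'I_m -> C),
     simple_reps X -> dual_Burnside X ->
     (\prod_(i < m) FPdim_simple X i) ^+ 2 /
       FPdim_sub X (adjoint_subcat (C := C)) \is a Num.int)
  /\
  (forall (C : modularCat R[i]) (m : nat) (X : 'I_m -> C),
     simple_reps X -> weakly_integral X ->
     prime_divisors (FPdim_cat X) =
     prime_divisors (FPdim_sub X (pointed_subcat (C := C))) `|`
     \bigcup_(i in [set: 'I_m]) prime_divisors (FPdim_simple X i ^+ 2)).
Proof.
split=> C m X hX; last exact: weakly_integral_prime_divisors.
have [e [st [hN Xe Xst]]] := fusion_rules_of_cat hX.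
exact: (dual_Burnside_integral hX hN Xe Xst).
Qed.
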